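(* For two generic sets of ordered points $\mathcal{X}=\{x_1,\dots,x_n\}$ and $\mathcal{Y}=\{y_1,\dots,y_n\}$ in $\mathbb{P}^3$, the centers-variety of $(\mathcal{X},\mathcal{Y})$ is $\mathbb{P}^3\times\mathbb{P}^3$ if $n\le 4$, and has dimension at least $14-2n$ if $n=5,6,7$.
   Context: All projective spaces are over $\mathbb{C}$. A projective camera is a linear map $A:\mathbb{P}^3\dashrightarrow\mathbb{P}^2$ represented (up to scale) by a $3\times 4$ matrix of rank three. Its center is the unique $a\in\mathbb{P}^3$ with $Aa=0$, and the image $Ax$ of $x\in\mathbb{P}^3$ is defined if and only if $x\ne a$. For cameras $A,B$ whose centers do not lie in $\mathcal{X}$, $\mathcal{Y}$ respectively, write $(Ax_i)_{i=1}^n\sim(By_i)_{i=1}^n$ if there is $H\in \mathrm{SL}(3)$ such that $Ax_i=HBy_i$ in $\mathbb{P}^2$ for all $i$. This condition depends on $A,B$ only through their centers. Let $2\mathcal{X}$ denote the union of all lines joining two distinct points of $\mathcal{X}$. The centers-variety of $(\mathcal{X},\mathcal{Y})$ is the Zariski closure in $\mathbb{P}^3\times\mathbb{P}^3$ of the locus of pairs of camera centers $(a,b)\in(\mathbb{P}^3\setminus\mathcal{X})\times(\mathbb{P}^3\setminus\mathcal{Y})$ such that cameras $A,B$ with centers $a,b$ satisfy $(Ax_i)_{i=1}^n\sim(By_i)_{i=1}^n$. For $n=5$ and $n=7$ the locus is further restricted to $a\notin 2\mathcal{X}$ and $b\notin 2\mathcal{Y}$ before taking the closure. ''Generic'' means: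 for all $(\mathcal{X},\mathcal{Y})$ in some nonempty Zariski open subset of $(\mathbb{P}^3)^n\times(\mathbb{P}^3)^n$. *)

(* Defs.v *)
From HB Require Import structures.
From mathcomp Require Import all_boot all_order all_algebra.
From mathcomp Require Import boolp classical_sets.
From mathcomp Require Import mpoly.

Set Implicit Arguments.
Unset Strict Implicit.
Unset Printing Implicit Defensive.

Import GRing.Theory.
Local Open Scope classical_set_scope.
Local Open Scope ring_scope.

(* Projective n-space: the lines through the origin of F^(n+1), so that equality
   of points is Leibniz equality. *)
Definition proj (F : fieldType) (n : nat) : Type :=
  {L : {vspace 'cV[F]_n.+1} | \dim L == 1%N}.

Section Zariski.
Variables (F : fieldType) (n : nat) (I : finType).

(* A family I -> proj F n is a point of the product of #|I| copies of P^n.  Its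
   multihomogeneous coordinate ring has one variable per pair (i, k), numbered
   by enum_rank (i, k): the k-th homogeneous coordinate of the i-th factor. *)
Let coord_ring := {mpoly F[#|{: I * 'I_n.+1}|]}.

Definition multihomogeneous (f : coord_ring) : Prop :=
  exists d : I -> nat, forall m, m \in msupp f ->
    forall i, (\sum_(k < n.+1) m (enum_rank (i, k)))%N = d i.

Definition represents (v : I -> 'cV[F]_n.+1) (p : I -> proj F n) : Prop :=
  forall i, val (p i) = <[v i]>%VS.

Definition vanishes_at (f : coord_ring) (p : I -> proj F n) : Prop :=
  forall v, represents v p ->
    f.@[fun t => v (enum_val t).1 (enum_val t).2 0] = 0.

Definition zariski_closed (Z : set (I -> proj F n)) : Prop :=
  exists2 S : set coord_ring, (forall f, S f -> multihomogeneous f) &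
    Z = [set p | forall f, S f -> vanishes_at f p].

Definition zariski_open (U : set (I -> proj F n)) : Prop :=
  zariski_closed (~` U).

Definition zariski_closure (A : set (I -> proj F n)) : set (I -> proj F n) :=
  \bigcap_(Z in [set Z | zariski_closed Z /\ A `<=` Z]) Z.

Definition irreducible_closed (Z : set (I -> proj F n)) : Prop :=
  [/\ zariski_closed Z, Z !=set0 &
      forall Z1 Z2, zariski_closed Z1 -> zariski_closed Z2 ->
        Z `<=` Z1 `|` Z2 -> Z `<=` Z1 \/ Z `<=` Z2].

(* The Krull dimension of the closed set V is at least d: there is a chain
   c 0 < ... < c d of irreducible closed subsets of V.  In particular V is
   nonempty when d = 0. *)
Definition dim_at_least (d : nat) (V : set (I -> proj F n)) : Prop :=
  exists c : nat -> set (I -> proj F n),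
    (forall i, (i <= d)%N -> irreducible_closed (c i) /\ c i `<=` V) /\
    (forall i, (i < d)%N -> c i `<` c i.+1).

End Zariski.

Definition pair_family (T I J : Type) (x : I -> T) (y : J -> T) (s : I + J) : T :=
  match s with inl i => x i | inr j => y j end.

Definition for_generic (F : fieldType) (N n : nat)
    (P : ('I_n -> proj F N) -> ('I_n -> proj F N) -> Prop) : Prop :=
  exists U : set ('I_n + 'I_n -> proj F N),
    [/\ zariski_open U, U !=set0 & forall x y, U (pair_family x y) -> P x y].

Section Cameras.
Variable F : fieldType.

(* The image of a point, as a subspace of F^3: it is a line, i.e. a point of
   P^2, unless A kills the point, in which case it is 0. *)
Definition image_point (A : 'M[F]_(3, 4)) (x : proj F 3) : {vspace 'cV[F]_3} :=
  (linfun (mulmx A) @: val x)%VS.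

Definition camera_with_center (A : 'M[F]_(3, 4)) (a : proj F 3) : Prop :=
  \rank A = 3%N /\ image_point A a = 0%VS.

Definition images_equiv (n : nat) (A B : 'M[F]_(3, 4))
    (x y : 'I_n -> proj F 3) : Prop :=
  exists2 H : 'M[F]_3, \det H = 1 &
    forall i, image_point A (x i) = (linfun (mulmx H) @: image_point B (y i))%VS.

Definition on_secant_line (n : nat) (x : 'I_n -> proj F 3) (a : proj F 3) : Prop :=
  exists i j, x i <> x j /\ (val a <= val (x i) + val (x j))%VS.

(* P^3 x P^3 is the space of families p : 'I_2 -> P^3, with p 0 the center of the
   first camera and p 1 that of the second one.  Cameras with given centers are
   unique up to left multiplication by an invertible matrix, and images_equiv is
   insensitive to it when F is algebraically closed, so that "some cameras" and
   "all cameras" with these centers agree. *)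
Definition centers_locus (n : nat) (x y : 'I_n -> proj F 3) :
    set ('I_2 -> proj F 3) :=
  [set p | let a := p ord0 in let b := p ord_max in
    [/\ forall i, a <> x i,
        forall i, b <> y i,
        exists A B, [/\ camera_with_center A a, camera_with_center B b &
                        images_equiv A B x y] &
        (n = 5%N \/ n = 7%N) -> ~ on_secant_line x a /\ ~ on_secant_line y b]].

Definition centers_variety (n : nat) (x y : 'I_n -> proj F 3) :
    set ('I_2 -> proj F 3) :=
  zariski_closure (centers_locus x y).

End Cameras.

(* Main.v *)
Require Import Defs.
From mathcomp Require Import all_boot all_order all_algebra.
From mathcomp Require Import fingroup perm.
From mathcomp Require Import boolp classical_sets reals.
From mathcomp.real_closed Require Import complex.
From mathcomp Require Import mpoly ring.

(** Two cameras A and B see the same picture when A x_i = lam_i B y_i for some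
   nonzero scalars lam_i, for chosen vectors x_i, y_i (the matrix H can be
   absorbed in B). Given A and lam, such a B exists exactly when the rescaled
   images A x_i / lam_i satisfy every linear relation l between the y_i
   (matching_camera). So everything is expressed by relations: the vectors
   obtained from the relations l by dividing by lam and combining the x_i must
   all be multiples of the centre a.

   For n <= 4 generic points there are no relations, and every pair of centres
   with nonzero coordinates is allowed. For n = 5 there is one relation on each
   side and lam is free, which gives a family with four parameters; for n = 6
   the relations form two pencils, and lam is determined by the choice of one
   relation in each, which gives a surface. Both families are written down
   explicitly (five_points_dim, six_points_dim).

   For n = 7 the relations form two spaces of dimension three, and lam has to
   carry a plane of one into a plane of the other. This amounts to a matrix S of
   rank two, with columns and rows in the two spaces of relations, whose
   diagonal vanishes. The diagonal conditions leave a pencil of candidates, and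
   a singular member of the pencil exists because the field is algebraically
   closed: this is the classical cubic equation for the fundamental matrix. For
   generic points no row or column of a candidate can vanish
   (bilinear_relation_row), which excludes rank one and makes the lam_i finite
   and nonzero; and the centres avoid the secant lines because the cross-ratios
   of four points seen from corresponding lines differ
   (center_off_first_secant).

   Two general tools connect this with the Zariski topology. A polynomial
   condition on representing vectors, multihomogeneous or not, yields an open
   condition on points (for_generic_of). And a polynomially parametrised family
   of points in a closed set bounds the dimension of that set from below
   (dim_at_least_param): the closures of the images of a flag of linear
   subspaces are irreducible, because irreducibility of affine space can be
   tested on lines. *)

Set Implicit Arguments.
Unset Strict Implicit.
Unset Printing Implicit Defensive.

Import Order.TTheory GRing.Theory Num.Theory.
Local Open Scope classical_set_scope.
Local Open Scope ring_scope.

(** * Polynomial functions of representing vectors *)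

Section Regular.
Variables (F : numClosedFieldType) (N : nat).
Implicit Types (I : finType).

(** The polynomials are evaluated with the numbering of the variables that the
   Zariski topology on families of points uses. *)
Definition eval I (f : {mpoly F[#|{: I * 'I_N.+1}|]}) (v : I -> 'cV[F]_N.+1) : F :=
  f.@[fun t => v (enum_val t).1 (enum_val t).2 0].

Definition regular I (g : (I -> 'cV[F]_N.+1) -> F) : Prop :=
  exists f, forall v, g v = eval f v.

Lemma evalE I (f : {mpoly F[#|{: I * 'I_N.+1}|]}) v :
  eval f v = \sum_(m <- msupp f) f@_m *
    \prod_i \prod_k v i k 0 ^+ m (enum_rank (i, k)).
Proof.
rewrite /eval mevalE; apply: eq_bigr => m _; congr (_ * _).
rewrite pair_big /= (reindex (@enum_rank {: I * 'I_N.+1})) /=; last first.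
  by exists enum_val => ? _; rewrite ?enum_rankK ?enum_valK.
by apply: eq_bigr => -[i k] _; rewrite enum_rankK.
Qed.

(** One statement covers both kinds of substitution: of regular functions
   (S consists of regular functions) and of polynomial curves (S consists of
   polynomial functions of one variable). *)
Lemma regular_subst I (T : Type) (S : (T -> F) -> Prop)
    (g : (I -> 'cV[F]_N.+1) -> F) (c : T -> I -> 'cV[F]_N.+1) :
  (forall a, S (fun=> a)) ->
  (forall p q, S p -> S q -> S (fun t => p t + q t)) ->
  (forall p q, S p -> S q -> S (fun t => p t * q t)) ->
  (forall i k, S (fun t => c t i k 0)) ->
  regular g -> S (fun t => g (c t)).
Proof.
move=> Sc Sa Sm Sv [f gf].
have -> : (fun t => g (c t)) = (fun t => \sum_(m <- msupp f) f@_m *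
    \prod_i \prod_k c t i k 0 ^+ m (enum_rank (i, k))).
  by apply/funext => t; rewrite gf evalE.
have Sprod (J : Type) (r : seq J) (G : J -> T -> F) :
    (forall j, S (G j)) -> S (fun t => \prod_(j <- r) G j t).
  move=> SG; elim: r => [|j r IH].
    by under eq_fun do rewrite big_nil; apply: Sc.
  by under eq_fun do rewrite big_cons; apply: Sm.
have Ssum (J : Type) (r : seq J) (G : J -> T -> F) :
    (forall j, S (G j)) -> S (fun t => \sum_(j <- r) G j t).
  move=> SG; elim: r => [|j r IH].
    by under eq_fun do rewrite big_nil; apply: Sc.
  by under eq_fun do rewrite big_cons; apply: Sa.
apply: (Ssum) => m; apply: (Sm) => //.
apply: (Sprod) => i; apply: (Sprod) => k.
elim: (m _) => [|e IH]; first by under eq_fun do rewrite expr0; apply: Sc.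
under eq_fun do rewrite exprS.
exact: Sm.
Qed.

Lemma regular_const I (a : F) : regular (fun _ : I -> 'cV[F]_N.+1 => a).
Proof. by exists a%:MP => v; rewrite /eval mevalC. Qed.

Lemma regular_coord I (i : I) k : regular (fun v => v i k 0).
Proof.
by exists 'X_(enum_rank (i, k)) => v; rewrite /eval mevalXU enum_rankK.
Qed.

Lemma regularD I (g h : (I -> 'cV[F]_N.+1) -> F) :
  regular g -> regular h -> regular (fun v => g v + h v).
Proof.
by move=> [p gp] [q hq]; exists (p + q) => v; rewrite /eval mevalD gp hq.
Qed.

Lemma regularM I (g h : (I -> 'cV[F]_N.+1) -> F) :
  regular g -> regular h -> regular (fun v => g v * h v).
Proof.
by move=> [p gp] [q hq]; exists (p * q) => v; rewrite /eval mevalM gp hq.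
Qed.

Lemma regularN I (g : (I -> 'cV[F]_N.+1) -> F) :
  regular g -> regular (fun v => - g v).
Proof. by move=> [p gp]; exists (- p) => v; rewrite /eval mevalN gp. Qed.

Lemma regularB I (g h : (I -> 'cV[F]_N.+1) -> F) :
  regular g -> regular h -> regular (fun v => g v - h v).
Proof. by move=> rg rh; apply: regularD => //; apply: regularN. Qed.

Lemma regular_sum I (J : Type) (r : seq J) (P : pred J)
    (g : J -> (I -> 'cV[F]_N.+1) -> F) :
  (forall j, regular (g j)) -> regular (fun v => \sum_(j <- r | P j) g j v).
Proof.
move=> rg; elim: r => [|j r IH].
  by under eq_fun do rewrite big_nil; apply: regular_const.
under eq_fun do rewrite big_cons.
by case: (P j) => //; apply: regularD.
Qed.

Lemma regular_prod I (J : Type) (r : seq J) (P : pred J)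
    (g : J -> (I -> 'cV[F]_N.+1) -> F) :
  (forall j, regular (g j)) -> regular (fun v => \prod_(j <- r | P j) g j v).
Proof.
move=> rg; elim: r => [|j r IH].
  by under eq_fun do rewrite big_nil; apply: regular_const.
under eq_fun do rewrite big_cons.
by case: (P j) => //; apply: regularM.
Qed.

Lemma regular_comp I (J : finType) (g : (J -> 'cV[F]_N.+1) -> F)
    (c : (I -> 'cV[F]_N.+1) -> J -> 'cV[F]_N.+1) :
  (forall j k, regular (fun v => c v j k 0)) -> regular g ->
  regular (fun v => g (c v)).
Proof.
move=> rc; apply: (@regular_subst J (I -> 'cV[F]_N.+1) (@regular I)) => //.
- exact: regular_const.
- by move=> p q; apply: regularD.
- by move=> p q; apply: regularM.
Qed.

Definition regular_mx I p q (A : (I -> 'cV[F]_N.+1) -> 'M[F]_(p, q)) : Prop :=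
  forall i j, regular (fun v => A v i j).

Lemma regular_mulmx I p q r (A : (I -> 'cV[F]_N.+1) -> 'M[F]_(p, q))
    (B : (I -> 'cV[F]_N.+1) -> 'M[F]_(q, r)) :
  regular_mx A -> regular_mx B -> regular_mx (fun v => A v *m B v).
Proof.
move=> rA rB i j; under eq_fun do rewrite mxE.
by apply: regular_sum => k; apply: regularM.
Qed.

Lemma regular_det I p (A : (I -> 'cV[F]_N.+1) -> 'M[F]_p) :
  regular_mx A -> regular (fun v => \det (A v)).
Proof.
move=> rA; apply: regular_sum => s; apply: regularM; first exact: regular_const.
by apply: regular_prod => i; apply: rA.
Qed.

Lemma regular_adj I p (A : (I -> 'cV[F]_N.+1) -> 'M[F]_p) :
  regular_mx A -> regular_mx (fun v => \adj (A v)).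
Proof.
move=> rA i j; under eq_fun do rewrite mxE.
apply: regularM; first exact: regular_const.
by apply: regular_det => k l; under eq_fun do rewrite !mxE; apply: rA.
Qed.

(** ** Restriction to curves *)

Definition poly_function (q : F -> F) : Prop := exists p : {poly F}, forall t, q t = p.[t].

Lemma poly_function_const a : poly_function (fun=> a).
Proof. by exists a%:P => t; rewrite hornerC. Qed.

Lemma poly_function_id : poly_function id.
Proof. by exists 'X => t; rewrite hornerX. Qed.

Lemma poly_functionD p q : poly_function p -> poly_function q -> poly_function (fun t => p t + q t).
Proof. by move=> [P hP] [Q hQ]; exists (P + Q) => t; rewrite hornerD hP hQ. Qed.

Lemma poly_functionM p q : poly_function p -> poly_function q -> poly_function (fun t => p t * q t).
Proof. by move=> [P hP] [Q hQ]; exists (P * Q) => t; rewrite hornerM hP hQ. Qed.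

Lemma poly_functionB p q : poly_function p -> poly_function q -> poly_function (fun t => p t - q t).
Proof. by move=> [P hP] [Q hQ]; exists (P - Q) => t; rewrite hornerD hornerN hP hQ. Qed.

Lemma poly_function_prod (J : Type) (r : seq J) (P : pred J) (g : J -> F -> F) :
  (forall j, poly_function (g j)) -> poly_function (fun t => \prod_(j <- r | P j) g j t).
Proof.
move=> rg; elim: r => [|j r IH].
  by under eq_fun do rewrite big_nil; apply: poly_function_const.
under eq_fun do rewrite big_cons.
by case: (P j) => //; apply: poly_functionM.
Qed.

Lemma regular_curve I (g : (I -> 'cV[F]_N.+1) -> F) (c : F -> I -> 'cV[F]_N.+1) :
  (forall i k, poly_function (fun t => c t i k 0)) -> regular g ->
  poly_function (fun t => g (c t)).
Proof.
move=> pc; apply: (@regular_subst I F poly_function) => //.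
- exact: poly_function_const.
- by move=> p q; apply: poly_functionD.
- by move=> p q; apply: poly_functionM.
Qed.

Lemma poly_nonroot (p : {poly F}) : p != 0 -> exists t, p.[t] != 0.
Proof.
move=> p0; apply: contrapT => /forallNP H.
have /(max_poly_roots p0) : all (root p) [seq i%:R | i <- iota 0 (size p)].
  by apply/allP => x _; apply/negPn/negP => h; apply: (H x).
rewrite size_map size_iota ltnn => H'; apply: notF; apply: H'.
by rewrite map_inj_uniq ?iota_uniq // => i j /eqP; rewrite eqr_nat => /eqP.
Qed.

(** This is the form in which the irreducibility of affine space is used: two
   nonvanishing conditions on a vector space are tested on a line through a
   witness of each. *)
Lemma poly_function_common_nonroot (p q : F -> F) s t :
  poly_function p -> poly_function q -> p s != 0 -> q t != 0 ->
  exists u, p u != 0 /\ q u != 0.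
Proof.
move=> [P hP] [Q hQ] ps qt.
have nz (R : {poly F}) x : R.[x] != 0 -> R != 0.
  by apply: contraNneq => ->; rewrite horner0.
have /poly_nonroot [u] : P * Q != 0.
  by rewrite mulf_neq0 ?(nz P s) ?(nz Q t) -?hP -?hQ.
by rewrite hornerM mulf_eq0 negb_or -hP -hQ => /andP[? ?]; exists u.
Qed.

Definition segment I (v w : I -> 'cV[F]_N.+1) (t : F) : I -> 'cV[F]_N.+1 :=
  fun i => v i + t *: (w i - v i).

Lemma segment0 I (v w : I -> 'cV[F]_N.+1) : segment v w 0 = v.
Proof. by apply/funext => i; rewrite /segment scale0r addr0. Qed.

Lemma segment1 I (v w : I -> 'cV[F]_N.+1) : segment v w 1 = w.
Proof. by apply/funext => i; rewrite /segment scale1r addrC subrK. Qed.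

Lemma regular_segment I (g : (I -> 'cV[F]_N.+1) -> F) v w :
  regular g -> poly_function (fun t => g (segment v w t)).
Proof.
apply: regular_curve => i k.
exists ((v i k 0)%:P + 'X * ((w i - v i) k 0)%:P) => t.
by rewrite hornerD hornerM hornerX !hornerC !mxE.
Qed.

Lemma regular_common_nonzero I (g h : (I -> 'cV[F]_N.+1) -> F) v w :
  regular g -> regular h -> g v != 0 -> h w != 0 ->
  exists u, g u != 0 /\ h u != 0.
Proof.
move=> rg rh gv hw.
have := poly_function_common_nonroot (regular_segment v w rg) (regular_segment v w rh).
move=> /(_ 0 1); rewrite segment0 segment1 => /(_ gv hw) [t ?].
by exists (segment v w t).
Qed.

(** ** Conditions that hold generically *)

(** Genericity is a condition on representing vectors, where any polynomial may
   be used, homogeneous or not; for_generic_of transfers it to points. Each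
   condition comes with its own witness, and the witnesses of a conjunction
   need not agree. *)
Definition generically I (C : (I -> 'cV[F]_N.+1) -> Prop) : Prop :=
  exists g, [/\ regular g, exists v, g v != 0 & forall v, g v != 0 -> C v].

Lemma generically_neq0 I (g : (I -> 'cV[F]_N.+1) -> F) v :
  regular g -> g v != 0 -> generically (fun v => g v != 0).
Proof. by move=> rg gv; exists g; split=> //; exists v. Qed.

Lemma genericallyS I (C D : (I -> 'cV[F]_N.+1) -> Prop) :
  (forall v, C v -> D v) -> generically C -> generically D.
Proof.
by move=> CD [g [rg [v gv] gC]]; exists g; split=> [//||w /gC/CD //]; exists v.
Qed.

Lemma generically_and I (C D : (I -> 'cV[F]_N.+1) -> Prop) :
  generically C -> generically D -> generically (fun v => C v /\ D v).
Proof.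
move=> [g [rg [v gv] gC]] [h [rh [w hw] hD]].
exists (fun v => g v * h v); split; first exact: regularM.
  have [u [gu hu]] := regular_common_nonzero rg rh gv hw.
  by exists u; rewrite mulf_neq0.
by move=> u; rewrite mulf_eq0 negb_or => /andP[/gC ? /hD ?].
Qed.

Lemma generically_forall I (J : finType) (C : J -> (I -> 'cV[F]_N.+1) -> Prop) :
  (forall j, generically (C j)) -> generically (fun v => forall j, C j v).
Proof.
move=> gC.
suff: generically (fun v => forall j, j \in enum J -> C j v).
  by apply: genericallyS => v Cv j; apply: Cv; rewrite mem_enum.
elim: (enum J) => [|j r IH].
  by exists (fun=> 1); split=> //; [exact: regular_const | exists (fun=> 0); exact: oner_neq0].
have := generically_and (gC j) IH; apply: genericallyS => v [Cj Cr] k.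
by rewrite inE => /orP[/eqP -> //|]; apply: Cr.
Qed.

Lemma generically_reindex I (C : (I -> 'cV[F]_N.+1) -> Prop) (s s' : I -> I) :
  cancel s' s -> cancel s s' -> generically C -> generically (fun v => C (v \o s)).
Proof.
move=> s'K sK [g [rg [v gv] gC]]; exists (fun v => g (v \o s)); split.
- by apply: (@regular_comp I I g (fun v => v \o s)) => // j k; apply: regular_coord.
- exists (v \o s').
  suff -> : (v \o s') \o s = v by [].
  by apply/funext => i /=; rewrite sK.
- by move=> w /gC.
Qed.

(** ** Openness of generic conditions *)

Lemma base_expansion_inj d B (a b : 'I_d -> nat) :
  (forall i, a i < B)%N -> (forall i, b i < B)%N ->
  (\sum_i a i * B ^ i = \sum_i b i * B ^ i)%N -> a =1 b.
Proof.
elim: d a b => [|d IH] a b aB bB; first by move=> _ [].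
rewrite !big_ord_recl /= !expn0 !muln1.
have shift (c : 'I_d.+1 -> nat) :
    (\sum_(i < d) c (lift ord0 i) * B ^ (bump 0 i) =
     (\sum_(i < d) c (lift ord0 i) * B ^ i) * B)%N.
  by rewrite big_distrl /=; apply: eq_bigr => i _; rewrite /bump /= add1n expnSr mulnA.
rewrite !shift => e.
have B0 : (0 < B)%N by apply: leq_ltn_trans (aB ord0).
have e0 : a ord0 = b ord0.
  have := congr1 (modn^~ B) e.
  by rewrite /= ![(_ + _ * B)%N]addnC !modnMDl !modn_small.
move: e; rewrite e0 => /addnI /eqP; rewrite eqn_pmul2r // => /eqP e.
have {}IH := IH (fun i => a (lift ord0 i)) (fun i => b (lift ord0 i))
  (fun i => aB _) (fun i => bB _) e.
by move=> i; have [j ->|->//] := unliftP ord0 i; apply: IH.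
Qed.

End Regular.

Section Points.
Variables (F : numClosedFieldType) (N : nat).
Implicit Types (I : finType).

Lemma exists_point (v : 'cV[F]_N.+1) : v != 0 -> exists p : proj F N, val p = <[v]>%VS.
Proof.
move=> v0; have dv : \dim <[v]>%VS == 1%N by rewrite dim_vline v0.
by exists (exist (fun L : {vspace 'cV[F]_N.+1} => \dim L == 1%N) <[v]>%VS dv).
Qed.

Lemma proj_repr (p : proj F N) : exists2 v : 'cV[F]_N.+1, v != 0 & val p = <[v]>%VS.
Proof.
case: p => L /= dL; exists (vpick L).
  by rewrite vpick0 -dimv_eq0 (eqP dL).
apply/esym/eqP; rewrite eqEdim -memvE memv_pick (eqP dL) dim_vline vpick0.
by rewrite -dimv_eq0 (eqP dL).
Qed.

Lemma represents_exists I (p : I -> proj F N) : exists v, represents v p.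
Proof.
have [v vp] := choice (fun i => let: ex_intro2 v _ h := proj_repr (p i) in
  ex_intro (fun v => val (p i) = <[v]>%VS) v h).
by exists v.
Qed.

Lemma point_exists I (v : I -> 'cV[F]_N.+1) :
  (forall i, v i != 0) -> exists p, represents v p.
Proof.
move=> v0; have [p pv] := choice (fun i => exists_point (v0 i)).
by exists p.
Qed.

Lemma represents_neq0 I (v : I -> 'cV[F]_N.+1) p i : represents v p -> v i != 0.
Proof.
move=> vp; have /eqP := valP (p i); rewrite vp dim_vline.
by case: (v i != 0).
Qed.

Lemma represents_scale I (v : I -> 'cV[F]_N.+1) p (c : I -> F) :
  (forall i, c i != 0) -> represents v p -> represents (fun i => c i *: v i) p.
Proof.
move=> c0 vp i; rewrite vp; apply/eqP; rewrite eqEsubv -!memvE.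
rewrite memvZ ?memv_line // andbT; apply/vlineP; exists (c i)^-1.
by rewrite scalerA mulVf ?scale1r.
Qed.

Lemma represents_eq I (v w : I -> 'cV[F]_N.+1) p :
  represents v p -> represents w p ->
  exists2 c : I -> F, (forall i, c i != 0) & w = (fun i => c i *: v i).
Proof.
move=> vp wp.
have /choice[c cE] : forall i, exists c, w i = c *: v i.
  move=> i; have : w i \in <[v i]>%VS by rewrite -vp wp memv_line.
  by move=> /vlineP[c ->]; exists c.
exists c; last by apply/funext.
move=> i; apply: contraNneq (represents_neq0 i wp) => c0.
by rewrite cE c0 scale0r.
Qed.

Section Components.
Variable I : finType.
Implicit Types (f : {mpoly F[#|{: I * 'I_N.+1}|]}) (v : I -> 'cV[F]_N.+1).

(** *** Multihomogeneous components *)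

Definition multideg (m : 'X_{1..#|{: I * 'I_N.+1}|}) (i : I) : nat :=
  (\sum_(k < N.+1) m (enum_rank (i, k)))%N.

Lemma eval_scale f v (c : I -> F) :
  eval f (fun i => c i *: v i) = \sum_(m <- msupp f)
    (\prod_i c i ^+ multideg m i) *
    (f@_m * \prod_i \prod_k v i k 0 ^+ m (enum_rank (i, k))).
Proof.
rewrite evalE; apply: eq_bigr => m _; rewrite mulrCA; congr (_ * _).
rewrite -big_split /=; apply: eq_bigr => i _.
rewrite /multideg -prodrXr -big_split /=; apply: eq_bigr => k _.
by rewrite mxE exprMn.
Qed.

Lemma eval_scale_multihomogeneous f v (c : I -> F) d :
  (forall m, m \in msupp f -> forall i, multideg m i = d i) ->
  eval f (fun i => c i *: v i) = (\prod_i c i ^+ d i) * eval f v.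
Proof.
move=> fd; rewrite eval_scale evalE big_distrr /= [LHS]big_seq [RHS]big_seq.
apply: eq_bigr => m mf; congr (_ * _).
by apply: eq_bigr => i _; rewrite fd.
Qed.

Lemma vanishes_atP f p v : multihomogeneous f -> represents v p ->
  vanishes_at f p <-> eval f v = 0.
Proof.
move=> [d fd] vp; split=> [|f0 w wp]; first by apply.
have [c _ ->] := represents_eq vp wp.
by rewrite [LHS](eval_scale_multihomogeneous v c fd) f0 mulr0.
Qed.

Definition component f (d : I -> nat) : {mpoly F[#|{: I * 'I_N.+1}|]} :=
  \sum_(m <- msupp f | [forall i, multideg m i == d i]) f@_m *: 'X_[m].

Lemma component_multihomogeneous f d : multihomogeneous (component f d).
Proof.
exists d => m mf i.
have := msupp_sum_le mf.
move=> /flatten_mapP[m']; rewrite mem_filter => /andP[/forallP/(_ i)/eqP <- _].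
by move/msuppZ_le; rewrite msuppX inE => /eqP ->.
Qed.

Lemma eval_component f d v : eval (component f d) v =
  \sum_(m <- msupp f | [forall i, multideg m i == d i])
    f@_m * \prod_i \prod_k v i k 0 ^+ m (enum_rank (i, k)).
Proof.
rewrite /eval /component raddf_sum /=; apply: eq_bigr => m _.
rewrite mevalZ mevalX; congr (_ * _).
rewrite pair_big /= (reindex (@enum_rank {: I * 'I_N.+1})) /=; last first.
  by exists enum_val => ? _; rewrite ?enum_rankK ?enum_valK.
by apply: eq_bigr => -[i k] _; rewrite enum_rankK.
Qed.

(** Rescaling the i-th vector by tau ^ (B ^ i), for B larger than all the
   degrees, gives different powers of tau to different multidegrees.  So a
   polynomial vanishes at all representatives of a point if and only if each of
   its multihomogeneous components does. *)
Lemma kronecker_scaling f v : exists (P : {poly F}) (c : F -> I -> F),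
  [/\ forall tau, tau != 0 -> forall i, c tau i != 0,
      forall tau, P.[tau] = eval f (fun i => c tau i *: v i),
      P.[1] = eval f v,
      forall m, m \in msupp f -> exists e, P`_e = eval (component f (multideg m)) v &
      forall e, P`_e = 0 \/
        exists2 m, m \in msupp f & P`_e = eval (component f (multideg m)) v].
Proof.
pose B := (\sum_(m <- msupp f) \sum_i multideg m i).+1.
have mB m i : m \in msupp f -> (multideg m i < B)%N.
  move=> mf; rewrite ltnS (big_rem m) //= (bigD1 i) //=.
  by rewrite -addnA leq_addr.
pose e m := (\sum_i multideg m i * B ^ enum_rank i)%N.
have e_inj m m' : m \in msupp f -> m' \in msupp f -> e m = e m' ->
    multideg m =1 multideg m'.
  move=> mf mf'; rewrite /e !(reindex (@enum_val I I)) /=; last 2 first.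
  - by exists enum_rank => ? _; rewrite ?enum_rankK ?enum_valK.
  - by exists enum_rank => ? _; rewrite ?enum_rankK ?enum_valK.
  under eq_bigr do rewrite enum_valK.
  under [in RHS]eq_bigr do rewrite enum_valK.
  move=> h i; rewrite -(enum_rankK i).
  by apply: (base_expansion_inj (B := B) _ _ h) => j; apply: mB.
pose term m := f@_m * \prod_i \prod_k v i k 0 ^+ m (enum_rank (i, k)).
pose P : {poly F} := \sum_(m <- msupp f) (term m)%:P * 'X^(e m).
have PE m : m \in msupp f -> P`_(e m) = eval (component f (multideg m)) v.
  move=> mf; rewrite /P coef_sum eval_component [RHS]big_mkcond /= [LHS]big_seq [RHS]big_seq.
  apply: eq_bigr => m' mf'; rewrite coefCM coefXn.
  case: forallP => [h|h].
    suff -> : e m = e m' by rewrite eqxx mulr1.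
    by apply: eq_bigr => i _; rewrite (eqP (h i)).
  case: eqP => [h'|]; last by rewrite mulr0.
  by case: h => i; rewrite (e_inj m' m).
exists P, (fun tau i => tau ^+ (B ^ enum_rank i)); split=> //.
- by move=> tau tau0 i; rewrite expf_neq0.
- move=> tau; rewrite eval_scale /P horner_sum; apply: eq_bigr => m _.
  rewrite hornerM hornerC hornerXn mulrC; congr (_ * _).
  rewrite -prodrXr; apply: eq_bigr => i _.
  by rewrite -exprM mulnC.
- rewrite /P horner_sum evalE; apply: eq_bigr => m _.
  by rewrite hornerM hornerC hornerXn expr1n mulr1.
- by move=> m mf; exists (e m); apply: PE.
move=> k; have [/hasP[m mf /eqP <-]|/hasPn nk] := boolP (has (fun m => e m == k) (msupp f)).
  by right; exists m => //; apply: PE.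
left; rewrite /P coef_sum big_seq big1 // => m mf.
by rewrite coefCM coefXn eq_sym (negPf (nk m mf)) mulr0.
Qed.

(** No homogeneity is assumed of f: vanishes_at quantifies over all representing
   vectors, so it already amounts to the vanishing of all components. *)
Lemma vanishes_at_closed f : zariski_closed [set p | vanishes_at f p].
Proof.
exists [set g | exists2 m, m \in msupp f & g = component f (multideg m)].
  by move=> g [m _ ->]; apply: component_multihomogeneous.
apply/seteqP; split=> p /=.
- move=> fp g [m mf ->] v vp.
  have [P [c [c0 Pc _ /(_ m mf) [e Pe] _]]] := kronecker_scaling f v.
  rewrite -[LHS]/(eval (component f (multideg m)) v) -Pe.
  suff -> : P = 0 by rewrite coef0.
  apply: contrapT => /eqP P0.
  have /poly_nonroot [t] : P * 'X != 0 by rewrite mulf_neq0 ?polyX_eq0.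
  rewrite hornerM hornerX mulf_eq0 negb_or => /andP[+ t0].
  rewrite Pc; case/negP; apply/eqP/fp/represents_scale => //.
  exact: c0.
- move=> fp v vp.
  have [P [_ [_ _ P1 _ Pe]]] := kronecker_scaling f v.
  suff P0 : P = 0 by rewrite -[LHS]/(eval f v) -P1 P0 horner0.
  apply/polyP => e; rewrite coef0; have [//|[m mf ->]] := Pe e.
  by apply: fp vp; exists m.
Qed.

End Components.

(** The open set consists of the points at some representatives of which the
   polynomial does not vanish; the representatives thus obtained are the ones
   to work with. *)
Lemma for_generic_of n (C : ('I_n + 'I_n -> 'cV[F]_N.+1) -> Prop)
    (P : ('I_n -> proj F N) -> ('I_n -> proj F N) -> Prop) :
  generically C ->
  (forall v x y, represents v (pair_family x y) -> C v -> P x y) ->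
  for_generic P.
Proof.
move=> gC CP.
have gnz : generically (fun v : 'I_n + 'I_n -> 'cV[F]_N.+1 => forall i, v i 0 0 != 0).
  apply: generically_forall => i.
  apply: (@generically_neq0 F N _ (fun v => v i 0 0) (fun=> const_mx 1)).
    exact: regular_coord.
  by rewrite mxE oner_neq0.
have [g [[f gf] [v gv] gC']] := generically_and gC gnz.
exists (~` [set p | vanishes_at f p]); split.
- by rewrite /zariski_open setCK; apply: vanishes_at_closed.
- have [_ v0] := gC' v gv.
  have [p vp] : exists p, represents v p.
    apply: point_exists => i; apply: contraNneq (v0 i) => ->.
    by rewrite mxE.
  exists p => /= /(_ v vp) fv0.
  by move: gv; rewrite gf [eval _ _]fv0 eqxx.
- move=> x y /= /existsNP[w /not_implyP[wp /eqP fw]].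
  have [Cw _] := gC' w ltac:(by rewrite gf).
  exact: CP wp Cw.
Qed.

(** * Closures of polynomially parametrised sets *)

Lemma zariski_closure_min I (A Z : set (I -> proj F N)) :
  zariski_closed Z -> A `<=` Z -> zariski_closure A `<=` Z.
Proof. by move=> cZ AZ p; apply; split. Qed.

Lemma sub_zariski_closure I (A : set (I -> proj F N)) : A `<=` zariski_closure A.
Proof. by move=> p Ap Z [_]; apply. Qed.

Lemma zariski_closure_closed I (A : set (I -> proj F N)) : zariski_closed (zariski_closure A).
Proof.
exists [set f | multihomogeneous f /\ A `<=` [set p | vanishes_at f p]].
  by move=> f [].
apply/seteqP; split=> p /=.
- move=> Ap f [hf Af]; apply: (Ap [set p | vanishes_at f p]); split=> //.
  exact: vanishes_at_closed.
- move=> h Z [[S hS ->] AZ] f Sf; apply: h; split; first exact: hS.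
  by move=> q /AZ; apply.
Qed.

(** A multihomogeneous equation may be tested on any representatives. *)
Lemma not_closed_point I (Z : set (I -> proj F N)) p v :
  zariski_closed Z -> represents v p -> ~ Z p ->
  exists f, [/\ multihomogeneous f, forall q, Z q -> vanishes_at f q & eval f v != 0].
Proof.
move=> [S hS ->] vp /= /existsNP[f /not_implyP[Sf nf]].
exists f; split; [exact: hS | by move=> q; apply|].
by apply/negP => /eqP/(vanishes_atP (hS f Sf) vp).
Qed.

(** An equation f of A vanishes identically: otherwise, on the line from a point
   where f is nonzero to the witness for g, both f and g would be nonzero
   somewhere, at a point of A. *)
Lemma zariski_closure_setT I (A : set (I -> proj F N)) (g : (I -> 'cV[F]_N.+1) -> F) v0 :
  regular g -> g v0 != 0 ->
  (forall v p, g v != 0 -> represents v p -> A p) ->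
  (forall v i, g v != 0 -> v i != 0) ->
  zariski_closure A = setT.
Proof.
move=> rg gv0 gA gnz; apply/seteqP; split=> // p _ Z [cZ AZ].
apply: contrapT => nZ.
have [v vp] := represents_exists p.
have [f [hf fZ fv]] := not_closed_point cZ vp nZ.
have rf : regular (eval f) by exists f.
have [w [fw gw]] := regular_common_nonzero rf rg fv gv0.
have [q qw] := point_exists (fun i => gnz w i gw).
by move: fw; rewrite [eval f w](fZ q (AZ _ (gA _ _ gw qw)) w qw) eqxx.
Qed.

Section Param.
Variables (I : finType) (d : nat).
Variables (phi : 'rV[F]_d -> I -> 'cV[F]_N.+1) (h : 'rV[F]_d -> F).

(** A record, so that unification does not unfold it to its quantifiers. *)
Record line_polynomial (g : 'rV[F]_d -> F) : Prop := LinePolynomial {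
  line_polynomialP : forall u w, poly_function (fun t => g (u + t *: w)) }.

Hypothesis phi_poly : forall i k, line_polynomial (fun u => phi u i k 0).
Hypothesis h_poly : line_polynomial h.
Hypothesis h0 : h 0 != 0.
Hypothesis phi_neq0 : forall u i, h u != 0 -> phi u i != 0.

Definition slice (j : nat) (u : 'rV[F]_d) : Prop :=
  forall i : 'I_d, (j <= i)%N -> u 0 i = 0.

Lemma slice_line j u w t : slice j u -> slice j w -> slice j (u + t *: w).
Proof. by move=> su sw i ji; rewrite !mxE su ?sw // mulr0 addr0. Qed.

Lemma sliceB j u w : slice j u -> slice j w -> slice j (u - w).
Proof. by move=> su sw i ji; rewrite !mxE su ?sw // subr0. Qed.

Lemma slice0 j : slice j 0.
Proof. by move=> i _; rewrite mxE. Qed.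

Definition image_slice (j : nat) : set (I -> proj F N) :=
  [set p | exists u, [/\ h u != 0, slice j u & represents (phi u) p]].

Lemma regular_param (g : (I -> 'cV[F]_N.+1) -> F) :
  regular g -> line_polynomial (fun u => g (phi u)).
Proof.
move=> rg; split=> u w; apply: (regular_curve _ rg) => i k.
exact: (line_polynomialP (phi_poly i k)).
Qed.

Lemma line_polynomial_common (g1 g2 : 'rV[F]_d -> F) j u w :
  line_polynomial g1 -> line_polynomial g2 -> slice j u -> slice j w ->
  g1 u != 0 -> g2 w != 0 -> exists z, [/\ slice j z, g1 z != 0 & g2 z != 0].
Proof.
move=> [p1] [p2] su sw g1u g2w.
have := poly_function_common_nonroot (s := 0) (t := 1) (p1 u (w - u)) (p2 u (w - u)).
rewrite scale0r addr0 scale1r addrC subrK => /(_ g1u g2w)[t [? ?]].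
exists (u + t *: (w - u)); split=> //.
by apply: slice_line => //; apply: sliceB.
Qed.

Lemma line_polynomialM (g1 g2 : 'rV[F]_d -> F) :
  line_polynomial g1 -> line_polynomial g2 -> line_polynomial (fun u => g1 u * g2 u).
Proof. by move=> [p1] [p2]; split=> u w; apply: poly_functionM. Qed.

(** Equations of the two closed sets, each nonzero at one parameter, are both
   nonzero at a common parameter where h does not vanish. *)
Lemma image_slice_irreducible j : irreducible_closed (zariski_closure (image_slice j)).
Proof.
split; first exact: zariski_closure_closed.
  have [p pv] := point_exists (fun i => phi_neq0 i h0).
  exists p; apply: sub_zariski_closure; exists 0; split=> //; exact: (@slice0 j).
move=> Z1 Z2 cZ1 cZ2 sZ; apply: contrapT => /not_orP[n1 n2].
have witness Z : zariski_closed Z -> ~ zariski_closure (image_slice j) `<=` Z ->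
    exists f u, [/\ multihomogeneous f, forall q, Z q -> vanishes_at f q,
      slice j u & eval f (phi u) != 0].
  move=> cZ nZ.
  have /existsNP[p /not_implyP[[u [hu su pu]] nZp]] : ~ image_slice j `<=` Z.
    by move=> /(zariski_closure_min cZ).
  have [f [hf fZ fu]] := not_closed_point cZ pu nZp.
  by exists f, u.
have [f1 [u1 [hf1 fZ1 s1 fu1]]] := witness _ cZ1 n1.
have [f2 [u2 [hf2 fZ2 s2 fu2]]] := witness _ cZ2 n2.
have rf (f : {mpoly F[#|{: I * 'I_N.+1}|]}) : line_polynomial (fun u => eval f (phi u)).
  by apply: regular_param; exists f.
have [z [sz hz fz1]] := line_polynomial_common h_poly (rf f1) (@slice0 _) s1 h0 fu1.
have := line_polynomial_common (line_polynomialM h_poly (rf f1)) (rf f2) sz s2.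
case=> [|//|w [sw]]; first by rewrite mulf_neq0.
rewrite mulf_eq0 negb_or => /andP[hw f1w f2w].
have [p pw] := point_exists (fun i => phi_neq0 i hw).
have : zariski_closure (image_slice j) p by apply: sub_zariski_closure; exists w.
move=> /sZ [/fZ1|/fZ2] /(_ _ pw) /eqP; apply/negP; [exact: f1w | exact: f2w].
Qed.

(** The chain consists of the closures of the images of the coordinate subspaces
   of the parameter space; f j is an equation of the j-th one that fails on the
   next. It has to be homogeneous only as far as its zeros are concerned. The
   condition h 0 != 0 makes h nonzero on every coordinate subspace. *)
Lemma dim_at_least_param (V : set (I -> proj F N))
    (f : 'I_d -> (I -> 'cV[F]_N.+1) -> F) :
  zariski_closed V ->
  (forall u p, h u != 0 -> represents (phi u) p -> V p) ->
  (forall j, regular (f j)) ->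
  (forall j v (c : I -> F), f j v = 0 -> f j (fun i => c i *: v i) = 0) ->
  (forall (j : 'I_d) u, slice j u -> f j (phi u) = 0) ->
  (forall j : 'I_d, exists2 u, slice j.+1 u & f j (phi u) != 0) ->
  dim_at_least d V.
Proof.
move=> cV hV rf f_scale f0 f1.
exists (fun j => zariski_closure (image_slice j)); split=> j jd.
  split; first exact: image_slice_irreducible.
  by apply: zariski_closure_min => // p [u [hu _ pu]]; apply: hV pu.
pose j' := Ordinal jd.
split.
  apply: zariski_closure_min; first exact: zariski_closure_closed.
  move=> p [u [hu su pu]]; apply: sub_zariski_closure; exists u; split=> //.
  by move=> i ji; apply: su; apply: leq_trans ji.
move=> subs.
have [u su fu] := f1 j'.
have [z [sz hz fz]] :=
  line_polynomial_common h_poly (regular_param (rf j')) (@slice0 _) su h0 fu.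
have [p pz] := point_exists (fun i => phi_neq0 i hz).
have [g gf] := rf j'.
have pj : zariski_closure (image_slice j) p.
  by apply: subs; apply: sub_zariski_closure; exists z.
have gp : vanishes_at g p.
  apply: (pj [set q | vanishes_at g q]); split; first exact: vanishes_at_closed.
  move=> q [u' [_ su' qu']] w qw.
  have [c _ wE] := represents_eq qu' qw.
  by rewrite -[LHS]/(eval g w) -gf wE; apply: f_scale; apply: f0.
by move: fz; rewrite gf [eval _ _](gp _ pz) eqxx.
Qed.

End Param.
End Points.

(** ** Parameters with polynomial dependence *)

Section LinePolynomials.
Variables (F : numClosedFieldType) (d : nat).
Implicit Types g : 'rV[F]_d -> F.

Lemma line_polynomial_const (a : F) : line_polynomial (fun _ : 'rV[F]_d => a).
Proof. by split=> u w; apply: poly_function_const. Qed.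

Lemma line_polynomial_coord (i : 'I_d) : line_polynomial (fun u : 'rV[F]_d => u 0 i).
Proof.
split=> u w; under eq_fun do rewrite !mxE.
apply: poly_functionD; first exact: poly_function_const.
by apply: poly_functionM; [exact: poly_function_id | exact: poly_function_const].
Qed.

Lemma line_polynomialD g1 g2 :
  line_polynomial g1 -> line_polynomial g2 -> line_polynomial (fun u => g1 u + g2 u).
Proof. by move=> [p1] [p2]; split=> u w; apply: poly_functionD. Qed.

Lemma line_polynomialB g1 g2 :
  line_polynomial g1 -> line_polynomial g2 -> line_polynomial (fun u => g1 u - g2 u).
Proof. by move=> [p1] [p2]; split=> u w; apply: poly_functionB. Qed.

Lemma line_polynomial_prod (J : Type) (r : seq J) (P : pred J) (g : J -> 'rV[F]_d -> F) :
  (forall j, line_polynomial (g j)) ->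
  line_polynomial (fun u => \prod_(j <- r | P j) g j u).
Proof.
move=> pg; split=> u w.
by apply: (@poly_function_prod F J r P (fun j t => g j (u + t *: w))) => j; case: (pg j).
Qed.

Lemma line_polynomial_sum (J : Type) (r : seq J) (P : pred J) (g : J -> 'rV[F]_d -> F) :
  (forall j, line_polynomial (g j)) ->
  line_polynomial (fun u => \sum_(j <- r | P j) g j u).
Proof.
move=> pg; elim: r => [|j r IH].
  by under eq_fun do rewrite big_nil; exact: line_polynomial_const.
under eq_fun do rewrite big_cons.
by case: (P j) => //; apply: line_polynomialD.
Qed.

Lemma line_polynomial_mulmx (T : 'M[F]_4) (z : 'rV[F]_d -> 'cV[F]_4) k :
  (forall i, line_polynomial (fun u => z u i 0)) ->
  line_polynomial (fun u => (T *m z u) k 0).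
Proof.
move=> pz; under eq_fun do rewrite mxE.
apply: line_polynomial_sum => i; apply: line_polynomialM => //.
exact: line_polynomial_const.
Qed.

(** A pair of centres depending on parameters, given in the coordinates of the
   two normal forms. *)
Definition center_pair (T T' : 'M[F]_4) (al be : 'rV[F]_d -> 'cV[F]_4) u (s : 'I_2) :=
  if s == ord0 then T *m al u else T' *m be u.

Lemma center_pair_line_polynomial (T T' : 'M[F]_4) (al be : 'rV[F]_d -> 'cV[F]_4) (s : 'I_2) k :
  (forall i, line_polynomial (fun u => al u i 0)) ->
  (forall i, line_polynomial (fun u => be u i 0)) ->
  line_polynomial (fun u => center_pair T T' al be u s k 0).
Proof.
move=> pa pb; rewrite /center_pair; case: (s == ord0).
  exact: (line_polynomial_mulmx T k pa).
exact: (line_polynomial_mulmx T' k pb).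
Qed.

Lemma center_pair_represents (T T' : 'M[F]_4) (al be : 'rV[F]_d -> 'cV[F]_4) u p :
  represents (center_pair T T' al be u) p ->
  val (p ord0) = <[T *m al u]>%VS /\ val (p ord_max) = <[T' *m be u]>%VS.
Proof. by move=> h; rewrite !h. Qed.

End LinePolynomials.

(** * Cameras seeing the same picture *)

Section Cameras.
Variable F : numClosedFieldType.

Lemma image_pointE (A : 'M[F]_(3, 4)) (x : proj F 3) v :
  val x = <[v]>%VS -> image_point A x = <[A *m v]>%VS.
Proof. by rewrite /image_point => ->; rewrite limg_line lfunE. Qed.

Lemma camera_with_centerP (A : 'M[F]_(3, 4)) (a : proj F 3) v :
  val a = <[v]>%VS -> \rank A = 3%N -> A *m v = 0 -> camera_with_center A a.
Proof.
move=> av rA Av; split=> //.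
by rewrite (image_pointE A av) Av; apply/eqP; rewrite -subv0 -memvE mem0v.
Qed.

Lemma rank_submx_exists m n r (M : 'M[F]_(m, n)) : (r <= \rank M)%N ->
  exists2 A : 'M[F]_(r, n), \rank A = r & (A <= M)%MS.
Proof.
move=> rM; exists (pid_mx r *m row_base M).
  by rewrite mxrankMfree ?row_base_free // rank_pid_mx.
by rewrite (submx_trans (submxMl _ _)) // eq_row_base.
Qed.

(** The rows of A X lie in the row space of X; after division by lam they lie in
   the row space of Y as soon as they are orthogonal to its kernel, the space of
   linear relations between the y_i. *)
Lemma matching_camera n (X Y : 'M[F]_(4, n)) (lam : 'rV[F]_n) (A : 'M[F]_(3, 4)) :
  \rank X = 4%N -> \rank A = 3%N -> (forall i, lam 0 i != 0) ->
  (forall l : 'cV_n, Y *m l = 0 -> A *m X *m diag_mx (map_mx GRing.inv lam) *m l = 0) ->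
  exists2 B : 'M[F]_(3, 4), \rank B = 3%N & A *m X = B *m Y *m diag_mx lam.
Proof.
move=> rX rA lam0 H.
set N := A *m X *m diag_mx _ in H.
have /submxP[B NB] : (N <= Y)%MS.
  rewrite submxE; apply/eqP/matrixP => i j.
  have /matrixP/(_ i 0) : N *m (cokermx Y *m delta_mx j (0 : 'I_1)) = 0.
    by apply: H; rewrite mulmxA mulmx_coker mul0mx.
  by rewrite mulmxA -colE !mxE.
have NE : A *m X = B *m Y *m diag_mx lam.
  rewrite -NB -mulmxA mulmx_diag (_ : diag_mx _ = 1%:M) ?mulmx1 //.
  by apply/matrixP => i j; rewrite !mxE mulVf.
exists B => //; apply/eqP; rewrite eqn_leq rank_leq_row /=.
have rAX : \rank (A *m X) = 3%N by rewrite mxrankMfree // /row_free rX.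
by rewrite -[X in (X <= _)%N]rAX NE -mulmxA mxrankM_maxl.
Qed.

(** The matrix of the equivalence can be absorbed in B, so H = 1 is enough. *)
Lemma images_equivP n (X Y : 'M[F]_(4, n)) (lam : 'rV[F]_n) (A B : 'M[F]_(3, 4)) x y :
  (forall i, lam 0 i != 0) -> A *m X = B *m Y *m diag_mx lam ->
  represents (fun i => col i X) x -> represents (fun i => col i Y) y ->
  images_equiv A B x y.
Proof.
move=> lam0 e xX yY; exists 1%:M; first exact: det1.
move=> i; rewrite (image_pointE A (xX i)) (image_pointE B (yY i)).
rewrite limg_line lfunE /= mul1mx.
have -> : A *m col i X = lam 0 i *: (B *m col i Y).
  rewrite !colE mulmxA e -!mulmxA !scalemxAr; congr (_ *m (_ *m _)).
  apply/matrixP => j k; rewrite mul_diag_mx !mxE.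
  by case: eqVneq => [->|]; rewrite // !mulr0.
apply/eqP; rewrite eqEsubv -!memvE memvZ ?memv_line //=.
by apply/vlineP; exists (lam 0 i)^-1; rewrite scalerA mulVf // scale1r.
Qed.

Lemma exists_camera (v : 'cV[F]_4) : exists2 A : 'M[F]_(3, 4), \rank A = 3%N & A *m v = 0.
Proof.
have [|A rA /sub_kermxP Av] := @rank_submx_exists _ _ 3 (kermx v).
  by rewrite mxrank_ker; case: (\rank v) (rank_leq_col v) => [|[]].
by exists A.
Qed.

Lemma rank_normal_form m (T : 'M[F]_4) (Q : 'M[F]_(4, m)) :
  T \in unitmx -> \rank (T *m row_mx 1%:M Q) = 4%N.
Proof.
move=> uT; apply/eqP; rewrite -[_ == _]/(row_free _) /row_free.
rewrite eqmxMfull ?row_full_unit //.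
rewrite -[X in _ == X](mxrank1 F 4) eqn_leq {1}mxrank1 rank_leq_row /=.
by rewrite (leq_trans _ (mxrankM_maxl _ (col_mx 1%:M 0))) // mul_row_col mulmx0 addr0 mulmx1.
Qed.

Lemma normal_form_entry m (Q : 'M[F]_(4, m)) (l1 : 'rV[F]_4) (l2 : 'rV[F]_m)
    (u : 'cV[F]_4) (w : 'cV[F]_m) i :
  (row_mx 1%:M Q *m diag_mx (row_mx l1 l2) *m col_mx u w) i 0 =
  l1 0 i * u i 0 + \sum_j Q i j * l2 0 j * w j 0.
Proof.
rewrite diag_mx_row mul_row_block !mulmx0 addr0 add0r mul_row_col mul1mx !mxE.
congr (_ + _).
  rewrite (bigD1 i) //= big1 ?addr0 => [|j ji]; first by rewrite mxE eqxx.
  by rewrite mxE eq_sym (negPf ji) mul0r.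
apply: eq_bigr => j _; congr (_ * _); rewrite mxE (bigD1 j) //= big1 => [|k kj].
  by rewrite mxE eqxx addr0.
by rewrite mxE (negPf kj) mulr0.
Qed.

(** A relation between the columns y_i of (1 | Q') has the form (- Q' w, w). The
   first condition says that its rescaling by 1 / lam is a relation between the
   columns x_i of (1 | Q) modulo alpha, hence is killed by any camera A with
   centre alpha. The second one says that beta is the sum of the lam_i k_i y_i
   for k = (c alpha - Q s, s), whose image under B is A (c alpha) = 0. *)
Lemma cameras_normal_form m (Q Q' : 'M[F]_(4, m)) (T T' : 'M[F]_4)
    (l1 : 'rV[F]_4) (l2 : 'rV[F]_m) x y a b
    (alpha beta : 'cV[F]_4) (s : 'cV[F]_m) (c : F) :
  T \in unitmx -> T' \in unitmx ->
  represents (fun i => col i (T *m row_mx 1%:M Q)) x ->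
  represents (fun i => col i (T' *m row_mx 1%:M Q')) y ->
  val a = <[T *m alpha]>%VS -> val b = <[T' *m beta]>%VS ->
  (forall i, l1 0 i != 0) -> (forall j, l2 0 j != 0) ->
  (forall w : 'cV_m, exists e, forall i,
     \sum_j Q i j * (l2 0 j)^-1 * w j 0 - (l1 0 i)^-1 * (\sum_j Q' i j * w j 0)
     = e * alpha i 0) ->
  (forall i, beta i 0 = l1 0 i * (c * alpha i 0 - \sum_j Q i j * s j 0)
                        + \sum_j Q' i j * l2 0 j * s j 0) ->
  exists A B, [/\ camera_with_center A a, camera_with_center B b & images_equiv A B x y].
Proof.
move=> uT uT' xT yT' aE bE l10 l20 Hw Hs.
have [A rA Aa] := exists_camera (T *m alpha).
pose lam := row_mx l1 l2.
have lam0 i : lam 0 i != 0 by rewrite mxE; case: split => j.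
have [|B rB e] := @matching_camera _ (T *m row_mx 1%:M Q) (T' *m row_mx 1%:M Q')
    lam A (rank_normal_form _ uT) rA lam0.
  move=> l Yl; pose u := usubmx l; pose w := dsubmx l.
  have uw : u = - (Q' *m w).
    have : row_mx 1%:M Q' *m l = 0.
      by rewrite -[LHS](mulKmx uT') (mulmxA T') Yl mulmx0.
    rewrite -[l]vsubmxK mul_row_col mul1mx -/u -/w => /eqP.
    by rewrite addr_eq0 => /eqP.
  have [e He] := Hw w.
  rewrite map_row_mx -!mulmxA (mulmxA (row_mx _ _)) -[l]vsubmxK -/u -/w.
  rewrite (_ : _ *m col_mx u w = e *: alpha); last first.
    apply/matrixP => i j; rewrite ord1 normal_form_entry [RHS]mxE -He addrC uw.
    congr (_ + _); first by apply: eq_bigr => ? _; rewrite mxE.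
    by rewrite !mxE mulrN.
  by rewrite -!scalemxAr Aa scaler0.
exists A, B; split.
- exact: camera_with_centerP aE rA Aa.
- apply: camera_with_centerP bE rB _.
  pose k := col_mx (c *: alpha - Q *m s) s.
  have -> : beta = row_mx 1%:M Q' *m diag_mx lam *m k.
    apply/matrixP => i j; rewrite ord1 normal_form_entry Hs !mxE.
    by [].
  rewrite (_ : _ *m _ = B *m (T' *m row_mx 1%:M Q') *m diag_mx lam *m k); last first.
    by rewrite !mulmxA.
  rewrite -e -!mulmxA mul_row_col mul1mx subrK -!scalemxAr.
  by rewrite Aa scaler0.
- exact: images_equivP lam0 e xT yT'.
Qed.

End Cameras.

(** * Coordinates on the two point sets *)

Section Configurations.
Variable F : numClosedFieldType.

Section Matrices.
Variable n : nat.
Implicit Types v : 'I_n + 'I_n -> 'cV[F]_4.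

Definition xmat v : 'M[F]_(4, n) := \matrix_(k, i) v (inl i) k 0.
Definition ymat v : 'M[F]_(4, n) := \matrix_(k, i) v (inr i) k 0.

Lemma regular_xmat : regular_mx xmat.
Proof. by move=> k i; under eq_fun do rewrite mxE; apply: regular_coord. Qed.

Lemma regular_ymat : regular_mx ymat.
Proof. by move=> k i; under eq_fun do rewrite mxE; apply: regular_coord. Qed.

Lemma col_xmat v i : col i (xmat v) = v (inl i).
Proof. by apply/matrixP => k j; rewrite !mxE ord1. Qed.

Lemma col_ymat v i : col i (ymat v) = v (inr i).
Proof. by apply/matrixP => k j; rewrite !mxE ord1. Qed.

Lemma represents_xmat v x y : represents v (pair_family x y) ->
  represents (fun i => col i (xmat v)) x.
Proof. by move=> h i; rewrite col_xmat; apply: (h (inl i)). Qed.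

Lemma represents_ymat v x y : represents v (pair_family x y) ->
  represents (fun i => col i (ymat v)) y.
Proof. by move=> h i; rewrite col_ymat; apply: (h (inr i)). Qed.

Lemma generically_mx (g : 'M[F]_(4, n) -> 'M[F]_(4, n) -> F) X Y :
  regular (fun v => g (xmat v) (ymat v)) -> g X Y != 0 ->
  generically (fun v => g (xmat v) (ymat v) != 0).
Proof.
move=> rg gXY; pose v (s : 'I_n + 'I_n) :=
  match s with inl i => col i X | inr i => col i Y end.
apply: (@generically_neq0 F 3 _ _ v) => //.
suff [-> ->] : xmat v = X /\ ymat v = Y by [].
by split; apply/matrixP => k i; rewrite !mxE.
Qed.

End Matrices.

Lemma scalecv_entry n (c : F) (z : 'cV[F]_n) i : (c *: z) i 0 = c * z i 0.
Proof. by rewrite mxE. Qed.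

Lemma sum_ord2 (f : 'I_2 -> F) : \sum_j f j = f 0 + f 1.
Proof. by rewrite !big_ord_recl big_ord0 addr0; congr (_ + f _); apply: val_inj. Qed.

Lemma unitmx_mul_neq0 (T : 'M[F]_4) (z : 'cV[F]_4) : T \in unitmx -> z != 0 -> T *m z != 0.
Proof.
by move=> uT; apply: contraNneq => Tz; rewrite -[z](mulKmx uT) Tz mulmx0.
Qed.

Lemma same_point_scale (T : 'M[F]_4) (z w : 'cV[F]_4) (p : proj F 3) :
  T \in unitmx -> val p = <[T *m z]>%VS -> val p = <[T *m w]>%VS ->
  exists c, z = c *: w.
Proof.
move=> uT pz pw; have : T *m z \in <[T *m w]>%VS by rewrite -pw pz memv_line.
move=> /vlineP[c e]; exists c.
by rewrite -[LHS](mulKmx uT) e -scalemxAr mulKmx.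
Qed.

Lemma regular_linear_coord (T : 'M[F]_4) (s : 'I_2) i :
  regular (fun w : 'I_2 -> 'cV[F]_4 => (T *m w s) i 0).
Proof.
apply: (@regular_mulmx F 3 _ 4 4 1 (fun=> T) (fun w => w s)).
  by move=> k l; apply: regular_const.
by move=> k l; rewrite ord1; apply: regular_coord.
Qed.

(** * At most four points *)

Section FewPoints.
Variable n : nat.
Hypothesis n4 : (n <= 4)%N.

(** Missing points are replaced by standard basis vectors, so that a single
   determinant expresses independence for every n <= 4. *)
Definition complete (X : 'M[F]_(4, n)) : 'M[F]_4 :=
  \matrix_(k, i) if insub (val i) is Some j then X k j else (k == i)%:R.

Lemma col_complete X (i : 'I_n) : col (widen_ord n4 i) (complete X) = col i X.
Proof. by apply/matrixP => k j; rewrite !mxE /= valK. Qed.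

Lemma regular_complete (I : finType) (A : (I -> 'cV[F]_4) -> 'M[F]_(4, n)) :
  regular_mx A -> regular_mx (fun v => complete (A v)).
Proof.
move=> rA k i; under eq_fun do rewrite mxE.
by case: insub => [j|]; [apply: rA | apply: regular_const].
Qed.

Lemma generically_complete : generically (fun v : 'I_n + 'I_n -> 'cV[F]_4 =>
  complete (xmat v) \in unitmx /\ complete (ymat v) \in unitmx).
Proof.
pose E : 'M[F]_(4, n) := \matrix_(k, i) ((k : nat) == i)%:R.
have EE : complete E = 1%:M.
  apply/matrixP => k i; rewrite !mxE; case: insubP => [j _ ji|]; last by [].
  by rewrite mxE ji.
have := @generically_mx n (fun X Y => \det (complete X) * \det (complete Y)) E E.
rewrite !EE det1 mulr1 => /(_ _ (oner_neq0 _)) H.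
apply: genericallyS (H _) => [v|].
  by rewrite mulf_eq0 negb_or !unitmxE !unitfE => /andP[].
apply: regularM; apply: regular_det; apply: regular_complete.
  exact: regular_xmat.
exact: regular_ymat.
Qed.

(** There are no relations to satisfy: for centres with nonzero coordinates
   alpha and beta, the rescaling beta_i / alpha_i works. *)
Lemma centers_variety_setT (v : 'I_n + 'I_n -> 'cV[F]_4) x y :
  represents v (pair_family x y) ->
  complete (xmat v) \in unitmx -> complete (ymat v) \in unitmx ->
  centers_variety x y = setT.
Proof.
move=> vxy; set T := complete _; set T' := complete (ymat v) => uT uT'.
pose g (w : 'I_2 -> 'cV[F]_4) := \prod_i (invmx T *m w ord0) i 0 *
  \prod_i (invmx T' *m w ord_max) i 0.
have gP w : g w != 0 -> (forall i, (invmx T *m w ord0) i 0 != 0) /\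
    (forall i, (invmx T' *m w ord_max) i 0 != 0).
  by rewrite mulf_eq0 negb_or => /andP[/prodf_neq0 h /prodf_neq0 h']; split=> i;
    [apply: h | apply: h'].
apply: (@zariski_closure_setT F 3 _ _ g
    (fun s => if s == ord0 then T *m const_mx 1 else T' *m const_mx 1)).
- by apply: regularM; apply: regular_prod => i; apply: regular_linear_coord.
- rewrite /g !mulKmx //= !big1 ?mulr1 ?oner_neq0 // => i _; by rewrite mxE.
- move=> w p /gP[]; set al := invmx T *m _; set be := invmx T' *m _ => al0 be0 wp.
  have aE : val (p ord0) = <[T *m al]>%VS by rewrite wp mulKVmx.
  have bE : val (p ord_max) = <[T' *m be]>%VS by rewrite wp mulKVmx.
  have other (i : 'I_4) : exists j : 'I_4, j != i.
    by exists (i + 1); rewrite -subr_eq0 addrAC subrr add0r.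
  have off (S : 'M[F]_4) (z : 'cV_4) (q : proj F 3) i : S \in unitmx ->
      (forall i, z i 0 != 0) -> val q = <[S *m z]>%VS -> val q <> <[col i S]>%VS.
    move=> uS z0 qz; rewrite colE => qi; have [c zc] := same_point_scale uS qz qi.
    have [j ji] := other i.
    by move: (z0 j); rewrite zc !mxE (negPf ji) mulr0 eqxx.
  split.
  + move=> i ai; have := represents_xmat vxy i; rewrite -(col_complete (xmat v)) -ai.
    exact: off aE.
  + move=> i bi; have := represents_ymat vxy i; rewrite -(col_complete (ymat v)) -bi.
    exact: off bE.
  + have col0 (S : 'M[F]_4) i : S \in unitmx ->
        col i (S *m row_mx 1%:M (0 : 'M_(4, 0))) != 0.
      move=> uS; rewrite mul_mx_row mulmx1.
      have [j ->|[]//] := split_ordP i; rewrite colKl colE unitmx_mul_neq0 //.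
      by apply/eqP => /matrixP/(_ j 0)/eqP; rewrite !mxE !eqxx oner_eq0.
    have [X xX] := point_exists (fun i => col0 T i uT).
    have [Y yY] := point_exists (fun i => col0 T' i uT').
    pose lam : 'rV[F]_4 := \row_i (be i 0 / al i 0).
    have [||w'|i|A [B [Aa Bb [H H1 eqAB]]]] := @cameras_normal_form F 0 0 0 T T' lam 0
      X Y _ _ al be 0 1 uT uT' xX yY aE bE.
    * by move=> i; rewrite mxE mulf_neq0 ?invr_neq0.
    * by move=> [].
    * by exists 0 => i; rewrite !big_ord0 mulr0 subr0 mul0r.
    * by rewrite !big_ord0 addr0 subr0 mul1r [X in X * _]mxE divfK.
    exists A, B; split=> //; exists H => // i.
    have lift_pt (S : 'M[F]_4) (z : 'I_n -> proj F 3) Z u :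
        represents (fun i => col i (S *m row_mx 1%:M (0 : 'M_(4, 0)))) Z ->
        val (z i) = <[u]>%VS -> col (widen_ord n4 i) S = u ->
        z i = Z (lshift 0 (widen_ord n4 i)).
      move=> ZS zu Su; apply: val_inj; rewrite zu ZS mul_mx_row mulmx1 colKl.
      by rewrite Su.
    rewrite (lift_pt T x X _ xX (represents_xmat vxy i) (col_complete _ i)).
    rewrite (lift_pt T' y Y _ yY (represents_ymat vxy i) (col_complete _ i)).
    exact: eqAB.
  + by move=> n57; exfalso; case: n57 n4 => ->.
- move=> w i /gP[al0 be0].
  have [->|->] : i = ord0 \/ i = ord_max.
  + by case: i => -[|[|//]] hi; [left | right]; apply: val_inj.
  + by apply: contraNneq (al0 0) => ->; rewrite mulmx0 mxE.
  + by apply: contraNneq (be0 0) => ->; rewrite mulmx0 mxE.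
Qed.

Lemma at_most_four_points :
  @for_generic F 3 n (fun x y => centers_variety x y = setT).
Proof.
apply: (for_generic_of generically_complete) => v x y vxy [uT uT'].
exact: (centers_variety_setT vxy).
Qed.

End FewPoints.

(** * Normal forms *)

Section NormalForm.
Variable m : nat.
Implicit Types X Y : 'M[F]_(4, 4 + m).

(** Up to the factor det (lsubmx X), the columns of coordmx X are the
   coordinates of the remaining points in the basis of the first four;
   the adjugate keeps them polynomial. *)
Definition coordmx X : 'M[F]_(4, m) := \adj (lsubmx X) *m rsubmx X.

Lemma regular_coordmx (I : finType) (A : (I -> 'cV[F]_4) -> 'M[F]_(4, 4 + m)) :
  regular_mx A -> regular_mx (fun v => coordmx (A v)).
Proof.
move=> rA; apply: regular_mulmx; first apply: regular_adj.
  by move=> i j; under eq_fun do rewrite mxE; apply: rA.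
by move=> i j; under eq_fun do rewrite mxE; apply: rA.
Qed.

Lemma coordmx_row Q : coordmx (row_mx 1%:M Q) = Q.
Proof.
rewrite /coordmx row_mxKl row_mxKr -[\adj _]mul1mx mul_mx_adj det1.
by rewrite mul1mx.
Qed.

Lemma coordmxE X : lsubmx X *m coordmx X = \det (lsubmx X) *: rsubmx X.
Proof. by rewrite mulmxA mul_mx_adj mul_scalar_mx. Qed.

Definition basis_condition X : Prop := lsubmx X \in unitmx.

Lemma generically_basis : generically (fun v : 'I_(4 + m) + 'I_(4 + m) -> 'cV[F]_4 =>
  basis_condition (xmat v) /\ basis_condition (ymat v)).
Proof.
pose E : 'M[F]_(4, 4 + m) := row_mx 1%:M 0.
have := @generically_mx _ (fun X Y => \det (lsubmx X) * \det (lsubmx Y)) E E.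
rewrite /E row_mxKl det1 mulr1 => /(_ _ (oner_neq0 _)) H.
apply: genericallyS (H _) => [v|].
  by rewrite /basis_condition mulf_eq0 negb_or !unitmxE !unitfE => /andP[].
apply: regularM; apply: regular_det => i j.
  by under eq_fun do rewrite mxE; apply: regular_xmat.
by under eq_fun do rewrite mxE; apply: regular_ymat.
Qed.

Lemma generically_coord_neq0 (j : 'I_m) :
  generically (fun v : 'I_(4 + m) + 'I_(4 + m) -> 'cV[F]_4 =>
    forall i, coordmx (xmat v) i j != 0 /\ coordmx (ymat v) i j != 0).
Proof.
apply: generically_forall => i.
pose E : 'M[F]_(4, 4 + m) := row_mx 1%:M (const_mx 1).
have := @generically_mx _ (fun X Y => coordmx X i j * coordmx Y i j) E E.
rewrite /E !coordmx_row !mxE mulr1 => /(_ _ (oner_neq0 _)) H.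
apply: genericallyS (H _) => [v|].
  by rewrite mulf_eq0 negb_or => /andP[].
by apply: regularM; apply: regular_coordmx; [apply: regular_xmat|apply: regular_ymat].
Qed.

(** The difference of the cross-ratios of x_1, x_2 and the points in positions
   j, j', seen from the line x_3 x_4, and of the corresponding points y, with
   denominators cleared. *)
Definition cross_ratio_gap (j j' : 'I_m) X Y : F :=
  coordmx X 0 j * coordmx X 1 j' * coordmx Y 1 j * coordmx Y 0 j' -
  coordmx X 1 j * coordmx X 0 j' * coordmx Y 0 j * coordmx Y 1 j'.

Lemma generically_cross_ratio (j j' : 'I_m) : j != j' ->
  generically (fun v : 'I_(4 + m) + 'I_(4 + m) -> 'cV[F]_4 =>
    cross_ratio_gap j j' (xmat v) (ymat v) != 0).
Proof.
move=> jj'.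
pose QX : 'M[F]_(4, m) := \matrix_(i, k) ((i == 0) && (k == j) || (i == 1) && (k == j'))%:R.
pose QY : 'M[F]_(4, m) := \matrix_(i, k) ((i == 1) && (k == j) || (i == 0) && (k == j'))%:R.
apply: (@generically_mx _ _ (row_mx 1%:M QX) (row_mx 1%:M QY)).
  by apply: regularB; do ![apply: regularM | apply: regular_coordmx;
    [exact: regular_xmat || exact: regular_ymat]].
rewrite /cross_ratio_gap !coordmx_row !mxE !eqxx /= (negPf jj').
by rewrite ?(mulr1, mul0r, mulr0, subr0) oner_neq0.
Qed.

(** Rescaling the first four vectors by the coordinates of the point in position
   j0 turns that point into the unit point of the frame. *)
Lemma exists_normal_form X x (j0 : 'I_m) :
  basis_condition X -> (forall i, coordmx X i j0 != 0) ->
  represents (fun i => col i X) x ->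
  exists2 T : 'M[F]_4, T \in unitmx & represents (fun i => col i (T *m row_mx 1%:M
    (\matrix_(i, j) (coordmx X i j / coordmx X i j0)))) x.
Proof.
move=> uX X0 xX.
have dX : \det (lsubmx X) != 0 by rewrite -unitfE -unitmxE.
pose p := \row_i coordmx X i j0.
pose c := row_mx p (const_mx (\det (lsubmx X))) : 'rV[F]_(4 + m).
exists (lsubmx X *m diag_mx p).
  rewrite unitmx_mul uX unitmxE det_diag unitfE; apply/prodf_neq0 => i _.
  by rewrite mxE.
have c0 i : c 0 i != 0.
  by rewrite mxE; case: split => j; rewrite mxE.
have := represents_scale c0 xX; congr (represents _ _); apply/funext => i.
have -> : c 0 i *: col i X = col i (X *m diag_mx c).
  by apply/matrixP => k l; rewrite mul_mx_diag !mxE mulrC.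
congr (col i _).
rewrite -{1}[X]hsubmxK diag_mx_row mul_row_block !mulmx0 addr0 add0r.
rewrite mul_mx_row mulmx1; congr (row_mx _ _).
rewrite diag_const_mx mul_mx_scalar -coordmxE -mulmxA; congr (_ *m _).
rewrite /p {c c0 p dX}; move: (coordmx X) X0 => C C0.
by apply/matrixP => k l; rewrite mul_diag_mx !mxE mulrC divfK.
Qed.

End NormalForm.
End Configurations.

(** * Five points *)

Section FivePoints.
Variable F : numClosedFieldType.

Lemma two_indices_avoiding (i j : nat) : exists k l : 'I_4,
  [/\ k != l, k != i :> nat, k != j :> nat, l != i :> nat & l != j :> nat].
Proof.
have [w [wA]] : exists w : 'I_4 * 'I_4, w.1 != w.2 /\
    [&& w.1 != i :> nat, w.1 != j :> nat, w.2 != i :> nat & w.2 != j :> nat].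
  case: i => [|[|[|[|i]]]]; case: j => [|[|[|[|j]]]];
  first [ by exists (inord 0, inord 1); rewrite -val_eqE /= !inordK
        | by exists (inord 0, inord 2); rewrite -val_eqE /= !inordK
        | by exists (inord 0, inord 3); rewrite -val_eqE /= !inordK
        | by exists (inord 1, inord 2); rewrite -val_eqE /= !inordK
        | by exists (inord 1, inord 3); rewrite -val_eqE /= !inordK
        | by exists (inord 2, inord 3); rewrite -val_eqE /= !inordK ].
by move=> /and4P[? ? ? ?]; exists w.1, w.2.
Qed.

Notation frame := (row_mx 1%:M (const_mx 1) : 'M[F]_(4, 4 + 1)).

Lemma frame_entry (k l : 'I_4) (i : 'I_(4 + 1)) :
  k != i :> nat -> l != i :> nat -> frame k i = frame l i.
Proof.
rewrite !mxE; case: split_ordP => j ->; rewrite !mxE // => /negPf ki /negPf li.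
by rewrite -!val_eqE ki li.
Qed.

(** Two of the first four indices differ from both i and j; at these two, every
   combination of the i-th and j-th vectors of the frame has equal coordinates. *)
Lemma injective_off_secants (T : 'M[F]_4) (z : 'cV[F]_4) (x : 'I_5 -> proj F 3) (p : proj F 3) :
  T \in unitmx -> represents (fun i : 'I_(4 + 1) => col i (T *m frame)) x ->
  val p = <[T *m z]>%VS -> (forall k l, k != l -> z k 0 != z l 0) ->
  (forall i j, ~ (val p <= val (x i) + val (x j))%VS).
Proof.
move=> uT xT pz zinj i j; rewrite pz xT (xT j) -memvE.
move=> /memv_addP[_ /vlineP[c ->]] [_ /vlineP[c' ->]] e.
have {}e : z = c *: col i frame + c' *: col j frame.
  rewrite -[LHS](mulKmx uT) e mulmxDr -!scalemxAr !colE -!mulmxA.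
  by rewrite !(mulKmx uT).
have [k [l [kl ki kj li lj]]] := two_indices_avoiding i j.
have zE q : z q 0 = c * frame q i + c' * frame q j.
  by rewrite e mxE; congr (_ + _); rewrite mxE; congr (_ * _); rewrite mxE.
have := zinj k l kl; rewrite !zE.
by rewrite !(frame_entry ki li) !(frame_entry kj lj) eqxx.
Qed.

(** For two projective frames, normalised by x_1 + ... + x_4 = x_5 and likewise for
   y, all relations are multiples of a single one, and every rescaling
   lam_i = 1 / mu_i gives a solution. If mu_5 = 1 and mu_i = 1 + t al_i, then
   a has coordinates al_i and b has coordinates al_i / (1 + t al_i). So a is
   arbitrary, and for fixed a the second centre runs along a rational curve. *)
Section FiveFrames.
Variables (T T' : 'M[F]_4) (x y : 'I_5 -> proj F 3).
Hypothesis uT : T \in unitmx.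
Hypothesis uT' : T' \in unitmx.
Hypothesis xT : represents (fun i : 'I_(4 + 1) => col i (T *m frame)) x.
Hypothesis yT : represents (fun i : 'I_(4 + 1) => col i (T' *m frame)) y.

(* The base point is t = 1, al = (1, 2, 3, 4). *)
Let t (u : 'rV[F]_4) : F := 1 + u 0 0.
Let al (u : 'rV[F]_4) : 'cV[F]_4 :=
  \col_i (i.+1%:R + (if i == 0 then 0 else u 0 i)).
Let be (u : 'rV[F]_4) : 'cV[F]_4 :=
  \col_i (al u i 0 * \prod_(j | j != i) (1 + t u * al u j 0)).
Let h (u : 'rV[F]_4) : F := t u * \prod_i (1 + t u * al u i 0) *
  \prod_i \prod_(j | j != i) (al u i 0 - al u j 0).

Let beE u i : be u i 0 = al u i 0 * \prod_(j | j != i) (1 + t u * al u j 0).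
Proof. by rewrite mxE. Qed.

Let t_poly : line_polynomial t.
Proof.
apply: line_polynomialD; first exact: line_polynomial_const.
exact: line_polynomial_coord.
Qed.

Let al_poly i : line_polynomial (fun u => al u i 0).
Proof.
under eq_fun do rewrite mxE.
apply: line_polynomialD; first exact: line_polynomial_const.
by case: (i == 0); [exact: line_polynomial_const | exact: line_polynomial_coord].
Qed.

Let mu_poly i : line_polynomial (fun u => 1 + t u * al u i 0).
Proof.
apply: line_polynomialD; first exact: line_polynomial_const.
by apply: line_polynomialM.
Qed.

Let be_poly i : line_polynomial (fun u => be u i 0).
Proof.
under eq_fun do rewrite mxE.
apply: line_polynomialM => //; exact: line_polynomial_prod.
Qed.

Let h_poly : line_polynomial h.
Proof.
apply: line_polynomialM.
  apply: line_polynomialM => //; exact: line_polynomial_prod.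
apply: line_polynomial_prod => i; apply: line_polynomial_prod => j.
exact: line_polynomialB.
Qed.

Let h_neq0 u : h u != 0 -> [/\ t u != 0, forall i, 1 + t u * al u i 0 != 0 &
  forall i j, i != j -> al u i 0 != al u j 0].
Proof.
rewrite !mulf_eq0 !negb_or => /andP[/andP[t0 /prodf_neq0 m0] /prodf_neq0 d0].
split=> // [i|i j ij]; first exact: m0.
have /prodf_neq0 := d0 i isT; move=> /(_ j).
by rewrite subr_eq0; apply; rewrite eq_sym.
Qed.

Let be_inj u : h u != 0 -> forall i j, i != j -> be u i 0 != be u j 0.
Proof.
move=> /h_neq0[t0 m0 d0] i j ij.
have beP k : be u k 0 * (1 + t u * al u k 0) = al u k 0 * \prod_l (1 + t u * al u l 0).
  by rewrite beE [in RHS](bigD1 k) //= -mulrA; congr (_ * _); rewrite mulrC.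
set P := \prod_l _ in beP.
have P0 : P != 0 by apply/prodf_neq0.
apply/negP => /eqP e.
have /eqP := beP i; rewrite e -(inj_eq (mulIf (m0 j))) mulrAC beP.
have -> : al u j 0 * P * (1 + t u * al u i 0) = al u i 0 * P * (1 + t u * al u j 0) +
  P * (al u j 0 - al u i 0) by ring.
rewrite -subr_eq0 addrAC subrr add0r mulf_eq0 (negPf P0) subr_eq0 /=.
by rewrite eq_sym (negPf (d0 i j ij)).
Qed.

Let inj_neq0 (z : 'cV[F]_4) : (forall i j, i != j -> z i 0 != z j 0) -> z != 0.
Proof. by move=> zi; apply: contraNneq (zi 0 1 isT) => ->; rewrite !mxE. Qed.

Let locus u p : h u != 0 -> represents (center_pair T T' al be u) p ->
  centers_locus x y p.
Proof.
move=> hu /center_pair_represents[aE bE].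
have [t0 m0 d0] := h_neq0 hu.
have offx := injective_off_secants uT xT aE d0.
have offy := injective_off_secants uT' yT bE (be_inj hu).
split.
- by move=> i ai; apply: (offx i i); rewrite ai addvSl.
- by move=> i bi; apply: (offy i i); rewrite bi addvSl.
- apply: (@cameras_normal_form F 1 (const_mx 1) (const_mx 1) T T'
    (\row_i (1 + t u * al u i 0)^-1) (const_mx 1) x y _ _ (al u) (be u)
    (const_mx ((\prod_i (1 + t u * al u i 0)) / t u)) 0) => //.
  + by move=> i; rewrite mxE invr_neq0.
  + by move=> i; rewrite mxE oner_neq0.
  + move=> w; exists (- t u * w 0 0) => i.
    rewrite !big_ord1 ![const_mx _ _ _]mxE [(\row__ _) _ _]mxE invrK invr1; ring.
  + move=> i; rewrite !big_ord1 ![const_mx _ _ _]mxE [(\row__ _) _ _]mxE beE.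
    rewrite [in RHS](bigD1 i) //=; set P := \prod_(j | j != i) _.
    by field; rewrite t0 m0.
- by move=> _; split=> -[i [j [_]]]; [apply: offx | apply: offy].
Qed.

(* The parameter u_0 moves b along a curve while a is fixed; the others move a. *)
Let sep (j : 'I_4) (w : 'I_2 -> 'cV[F]_4) : F :=
  if j == 0 then (invmx T' *m w ord_max) 0 0 * be 0 1 0 -
                 (invmx T' *m w ord_max) 1 0 * be 0 0 0
  else (invmx T *m w ord0) 0 0 * j.+1%:R - (invmx T *m w ord0) j 0.

Lemma five_points_dim : dim_at_least 4 (centers_variety x y).
Proof.
have al0 i : al 0 i 0 = i.+1%:R by rewrite mxE; case: (i == 0); rewrite ?mxE addr0.
have t0 : t 0 = 1 by rewrite /t mxE addr0.
apply: (@dim_at_least_param F 3 _ 4 (center_pair T T' al be) h _ h_poly _ _ _ sep).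
- by move=> i k; apply: center_pair_line_polynomial.
- rewrite /h t0 mul1r mulf_neq0 //.
    by apply/prodf_neq0 => i _; rewrite al0 mul1r nat1r pnatr_eq0.
  apply/prodf_neq0 => i _; apply/prodf_neq0 => j ji.
  by rewrite !al0 subr_eq0 eqr_nat eqSS eq_sym.
- move=> u i hu; have [_ _ d0] := h_neq0 hu.
  rewrite /center_pair; case: (i == ord0); apply: unitmx_mul_neq0 => //.
    exact: inj_neq0.
  exact: inj_neq0 (be_inj hu).
- exact: zariski_closure_closed.
- by move=> u p hu up; apply: sub_zariski_closure; apply: locus up.
- move=> j; rewrite /sep; case: (j == 0); apply: regularB; try apply: regularM;
    do ?[exact: regular_linear_coord | exact: regular_const].
- move=> j w c; rewrite /sep; case: (j == 0) => e; rewrite -!scalemxAr !scalecv_entry.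
    by rewrite -!mulrA -mulrBr e mulr0.
  by rewrite -mulrA -mulrBr e mulr0.
- move=> j u su; rewrite /sep /center_pair /=; case: eqP su => [->|/eqP j0] su.
    have -> : u = 0 by apply/matrixP => a b; rewrite ord1 su // mxE.
    by rewrite mulKmx // mulrC subrr.
  by rewrite mulKmx // !mxE /= (negPf j0) su // !addr0 mul1r subrr.
- move=> j; pose u : 'rV[F]_4 := \row_i (if i == j then 4%:R else 0).
  exists u; first by move=> i ij; rewrite mxE; case: eqP ij => // ->; rewrite ltnn.
  rewrite /sep /center_pair /=; case: (j =P 0) => [j0|/eqP j0]; rewrite !mulKmx //.
    have tu : t u = 5%:R by rewrite /t mxE j0 eqxx; ring.
    have alu i : al u i 0 = i.+1%:R.
      by rewrite mxE; case: ifP => [|i0]; rewrite ?addr0 // mxE j0 i0 addr0.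
    rewrite !beE ![\prod_(_ | _) _]big_mkcond !big_ord_recl !big_ord0 !al0 !alu t0 tu.
    rewrite /= /bump /= !addn0 !add1n modn_small //.
    rewrite (_ : _ - _ = 336%:R * 160%:R) ?mulf_neq0 ?pnatr_eq0 //; ring.
  rewrite [al u 0 0]mxE [al u j 0]mxE /= (negPf j0) mxE eqxx opprD addrA.
  by rewrite addr0 mul1r subrr add0r oppr_eq0 pnatr_eq0.
Qed.

End FiveFrames.

Lemma five_points : @for_generic F 3 5 (fun x y => dim_at_least 4 (centers_variety x y)).
Proof.
have gC := generically_and (@generically_basis F 1) (@generically_coord_neq0 F 1 0).
apply: (for_generic_of gC) => v x y vxy [[bx by'] c0].
have norm X z : basis_condition X -> (forall i, coordmx X i 0 != 0) ->
    represents (fun i => col i X) z -> exists2 T : 'M[F]_4, T \in unitmx &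
    represents (fun i : 'I_(4 + 1) => col i (T *m frame)) z.
  move=> bX X0 zX; have [T uT] := exists_normal_form bX X0 zX.
  rewrite (_ : \matrix_(_, _) _ = const_mx 1); first by exists T.
  by apply/matrixP => i j; rewrite ord1 [RHS]mxE [LHS]mxE divff.
have [T uT xT] := norm _ x bx (fun i => (c0 i).1) (represents_xmat vxy).
have [T' uT' yT] := norm _ y by' (fun i => (c0 i).2) (represents_ymat vxy).
exact: five_points_dim uT uT' xT yT.
Qed.

End FivePoints.

(** * Six points *)

Section SixPoints.
Variable F : numClosedFieldType.

Lemma linear_poly_neq0 (a b : F) : (a != 0) || (b != 0) -> a%:P - b *: 'X != 0.
Proof.
move=> ab; apply/eqP => e.
have /eqP : (a%:P - b *: 'X)`_1 = 0 by rewrite e coef0.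
have /eqP : (a%:P - b *: 'X)`_0 = 0 by rewrite e coef0.
rewrite !(coefB, coefZ, coefX, coefC) /= mulr1 mulr0 sub0r subr0 oppr_eq0.
by move=> a0 b0; move: ab; rewrite a0 b0.
Qed.

(** For a point z that coincides with one of the six columns of (1 | Q), where
   the fifth is the unit point, one of the factors vanishes. *)
Definition nondegenerate (z : 'cV[F]_4) (Q : 'M[F]_(4, 2)) : F :=
  z 0 0 * z 1 0 * (z 0 0 - z 1 0) * (z 0 0 * Q 1 1 - z 1 0 * Q 0 1).

Lemma nondegenerate_off_points (T : 'M[F]_4) (Q : 'M[F]_(4, 2)) (z : 'cV[F]_4)
    (x : 'I_6 -> proj F 3) (p : proj F 3) :
  T \in unitmx -> (forall i, Q i 0 = 1) ->
  represents (fun i : 'I_(4 + 2) => col i (T *m row_mx 1%:M Q)) x ->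
  val p = <[T *m z]>%VS -> nondegenerate z Q != 0 -> forall i, p <> x i.
Proof.
move=> uT Q1 xT pz; rewrite !mulf_eq0 !negb_or => /andP[/andP[/andP[z0 z1] z01] z2] i pi.
have := xT i; rewrite -pi colE -mulmxA => px.
have [c zc] := same_point_scale uT pz px.
have {}zc k : z k 0 = c * row_mx 1%:M Q k i by rewrite zc mxE -colE [in LHS]mxE.
have [j ij|j ij] := split_ordP (i : 'I_(4 + 2)).
  have zj k : z k 0 = c * (k == j)%:R by rewrite zc ij row_mxEl mxE.
  have [j0|j0] := eqVneq j 0.
    by move: z1; rewrite zj j0 mulr0 eqxx.
  by move: z0; rewrite zj [0 == j]eq_sym (negPf j0) mulr0 eqxx.
have zj k : z k 0 = c * Q k j by rewrite zc ij row_mxEr.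
have [jE|jE] : j = 0 \/ j = 1.
- by case: j {ij zj} => -[|[|//]] hj; [left | right]; apply: val_inj.
- by move: z01; rewrite !zj jE !Q1 subrr eqxx.
- by move: z2; rewrite !zj jE mulrAC subrr eqxx.
Qed.

Lemma exists_base_slope (Q Q' : 'M[F]_(4, 2)) :
  Q 1 1 * Q' 0 1 - Q 0 1 * Q' 1 1 != 0 -> exists s : F, [/\ s != 0, Q' 0 1 - s * Q 0 1 != 0,
  Q' 1 1 - s * Q 1 1 != 0 & (Q' 0 1 - Q' 1 1) - s * (Q 0 1 - Q 1 1) != 0].
Proof.
move=> gap.
have h0 : (Q' 0 1 != 0) || (Q 0 1 != 0).
  rewrite -negb_and; apply: contraNN gap => /andP[/eqP -> /eqP ->].
  by rewrite mulr0 mul0r subrr.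
have h1 : (Q' 1 1 != 0) || (Q 1 1 != 0).
  rewrite -negb_and; apply: contraNN gap => /andP[/eqP -> /eqP ->].
  by rewrite mulr0 mul0r subrr.
have h2 : (Q' 0 1 - Q' 1 1 != 0) || (Q 0 1 - Q 1 1 != 0).
  rewrite -negb_and; apply: contraNN gap; rewrite !subr_eq0 => /andP[/eqP -> /eqP ->].
  by [].
have /poly_nonroot[s] : 'X * ((Q' 0 1)%:P - Q 0 1 *: 'X) * ((Q' 1 1)%:P - Q 1 1 *: 'X) *
    ((Q' 0 1 - Q' 1 1)%:P - (Q 0 1 - Q 1 1) *: 'X) != 0.
  by rewrite !mulf_neq0 ?polyX_eq0 ?linear_poly_neq0.
rewrite !hornerE !mulf_eq0 !negb_or => /andP[/andP[/andP[s0 ?] ?] ?].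
by exists s; split=> //; rewrite mulrC.
Qed.

(** A rescaling is good as soon as it carries one relation l between the y_i to
   a relation k between the x_i; the pairs (k, l) form a surface. With x_5 and
   y_5 the unit points and q, q' the coordinates of x_6, y_6, the relations
   k = (1 + t sigma q, -1, - t sigma) and l = (1 + t q', -1, - t) give
   lam_i = (1 + t q'_i) / (1 + t sigma q_i), lam_5 = 1, lam_6 = 1 / sigma, and
   the centres a_i = (q'_i - sigma q_i) / (1 + t q'_i),
   b_i = (q'_i - sigma q_i) / (1 + t sigma q_i), which remain meaningful at
   t = 0. *)
Section SixNormalForm.
Variables (Q Q' : 'M[F]_(4, 2)) (T T' : 'M[F]_4) (x y : 'I_6 -> proj F 3).
Hypothesis uT : T \in unitmx.
Hypothesis uT' : T' \in unitmx.
Hypothesis Q1 : forall i, Q i 0 = 1.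
Hypothesis Q'1 : forall i, Q' i 0 = 1.
Hypothesis xT : represents (fun i : 'I_(4 + 2) => col i (T *m row_mx 1%:M Q)) x.
Hypothesis yT : represents (fun i : 'I_(4 + 2) => col i (T' *m row_mx 1%:M Q')) y.
Hypothesis gap : Q 1 1 * Q' 0 1 - Q 0 1 * Q' 1 1 != 0.

Variable s : F.
Hypothesis s0 : s != 0.
Hypothesis z0 : Q' 0 1 - s * Q 0 1 != 0.
Hypothesis z1 : Q' 1 1 - s * Q 1 1 != 0.
Hypothesis z01 : (Q' 0 1 - Q' 1 1) - s * (Q 0 1 - Q 1 1) != 0.

(* The base point is sigma = s, t = 0, where both centres have coordinates
   q' - s q. *)
Let sg (u : 'rV[F]_2) : F := s + u 0 0.
Let t (u : 'rV[F]_2) : F := u 0 1.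
Let z u i : F := Q' i 1 - sg u * Q i 1.
Let ma u i : F := 1 + t u * Q' i 1.
Let mb u i : F := 1 + t u * sg u * Q i 1.
Let al u : 'cV[F]_4 := \col_i (z u i * \prod_(j | j != i) ma u j).
Let be u : 'cV[F]_4 := \col_i (z u i * \prod_(j | j != i) mb u j).
Let h u : F := sg u * \prod_i ma u i * \prod_i mb u i *
  nondegenerate (al u) Q * nondegenerate (be u) Q'.

Let alE u i : al u i 0 = z u i * \prod_(j | j != i) ma u j.
Proof. by rewrite mxE. Qed.

Let beE u i : be u i 0 = z u i * \prod_(j | j != i) mb u j.
Proof. by rewrite mxE. Qed.

Let cst a : line_polynomial (fun _ : 'rV[F]_2 => a).
Proof. exact: line_polynomial_const. Qed.

Let sg_poly : line_polynomial sg.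
Proof. by apply: line_polynomialD => //; apply: line_polynomial_coord. Qed.

Let t_poly : line_polynomial t.
Proof. exact: line_polynomial_coord. Qed.

Let z_poly i : line_polynomial (z^~ i).
Proof. by apply: line_polynomialB => //; apply: line_polynomialM. Qed.

Let ma_poly i : line_polynomial (ma^~ i).
Proof. by apply: line_polynomialD => //; apply: line_polynomialM. Qed.

Let mb_poly i : line_polynomial (mb^~ i).
Proof.
by apply: line_polynomialD => //; apply: line_polynomialM => //; apply: line_polynomialM.
Qed.

Let al_poly i : line_polynomial (fun u => al u i 0).
Proof.
under eq_fun do rewrite mxE.
by apply: line_polynomialM => //; apply: line_polynomial_prod.
Qed.

Let be_poly i : line_polynomial (fun u => be u i 0).
Proof.
under eq_fun do rewrite mxE.
by apply: line_polynomialM => //; apply: line_polynomial_prod.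
Qed.

Let nondegenerate_poly (c : 'rV[F]_2 -> 'cV[F]_4) (R : 'M[F]_(4, 2)) :
  (forall i, line_polynomial (fun u => c u i 0)) ->
  line_polynomial (fun u => nondegenerate (c u) R).
Proof.
move=> pc; rewrite /nondegenerate.
by do ![apply: line_polynomialM => // | apply: line_polynomialB => //].
Qed.

Let h_poly : line_polynomial h.
Proof.
apply: line_polynomialM; last exact: nondegenerate_poly.
apply: line_polynomialM; last exact: nondegenerate_poly.
apply: line_polynomialM; last exact: line_polynomial_prod.
by apply: line_polynomialM; last exact: line_polynomial_prod.
Qed.

Let h_neq0 u : h u != 0 -> [/\ sg u != 0, forall i, ma u i != 0, forall i, mb u i != 0,
  nondegenerate (al u) Q != 0 & nondegenerate (be u) Q' != 0].
Proof.
have factors (a b : F) : a * b != 0 -> a != 0 /\ b != 0.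
  by rewrite mulf_eq0 negb_or => /andP[].
move=> /factors[/factors[/factors[/factors[-> /prodf_neq0 a0] /prodf_neq0 b0] na] nb].
by split=> // i; [apply: a0 | apply: b0].
Qed.

Let locus u p : h u != 0 -> represents (center_pair T T' al be u) p ->
  centers_locus x y p.
Proof.
move=> hu /center_pair_represents[aE bE].
have [sg0 ma0 mb0 na nb] := h_neq0 hu.
split; last by case.
- exact: nondegenerate_off_points uT Q1 xT aE na.
- exact: nondegenerate_off_points uT' Q'1 yT bE nb.
pose l2 : 'rV[F]_2 := \row_j (if j == 0 then 1 else (sg u)^-1).
pose r : 'cV[F]_2 := \col_j (if j == 0 then 0 else sg u * \prod_i mb u i).
apply: (@cameras_normal_form F 2 Q Q' T T' (\row_i (ma u i / mb u i)) l2 x y _ _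
  (al u) (be u) r 0) => //.
- by move=> i; rewrite mxE mulf_neq0 ?invr_neq0.
- by move=> j; rewrite mxE; case: (j == 0); rewrite ?oner_neq0 ?invr_neq0.
- move=> w; exists ((t u * w 0 0 - w 1 0) / \prod_i ma u i) => i.
  rewrite !sum_ord2.
  rewrite [l2 0 0]mxE [l2 0 1]mxE [(\row__ _) _ _]mxE alE [in RHS](bigD1 i) //=.
  set P := \prod_(j | j != i) _; have P0 : P != 0 by apply/prodf_neq0.
  have mai := ma0 i; have mbi := mb0 i.
  rewrite !Q1 !Q'1 /z; move: mai mbi; rewrite /ma /mb => mai mbi.
  by field; rewrite ?P0 ?mai ?mbi ?sg0.
- move=> i; rewrite !sum_ord2.
  rewrite [l2 0 0]mxE [l2 0 1]mxE [(\row__ _) _ _]mxE [r 0 0]mxE [r 1 0]mxE beE /=.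
  rewrite [in RHS](bigD1 i) //=.
  set P := \prod_(j | j != i) _.
  have mai := ma0 i; have mbi := mb0 i.
  move: mai mbi; rewrite /z /ma /mb => mai mbi.
  by field; rewrite ?mai ?mbi ?sg0.
Qed.

(* At t = 0 both centres have the same coordinates, which run along a line with
   sigma; t makes the coordinates differ. *)
Let sep (j : 'I_2) (w : 'I_2 -> 'cV[F]_4) : F :=
  if j == 0 then (invmx T *m w ord0) 0 0 * z 0 1 - (invmx T *m w ord0) 1 0 * z 0 0
  else (invmx T *m w ord0) 0 0 * (invmx T' *m w ord_max) 1 0 -
       (invmx T *m w ord0) 1 0 * (invmx T' *m w ord_max) 0 0.

Lemma six_points_dim : dim_at_least 2 (centers_variety x y).
Proof.
have z0E i : z 0 i = Q' i 1 - s * Q i 1 by rewrite /z /sg mxE addr0.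
have maE u i : t u = 0 -> ma u i = 1 by rewrite /ma => ->; rewrite mul0r addr0.
have mbE u i : t u = 0 -> mb u i = 1 by rewrite /mb => ->; rewrite !mul0r addr0.
have alt u i : t u = 0 -> al u i 0 = z u i.
  by move=> tu; rewrite alE big1 ?mulr1 // => j _; apply: maE.
have bet u i : t u = 0 -> be u i 0 = z u i.
  by move=> tu; rewrite beE big1 ?mulr1 // => j _; apply: mbE.
have t0 : t 0 = 0 by rewrite /t mxE.
apply: (@dim_at_least_param F 3 _ 2 (center_pair T T' al be) h _ h_poly _ _ _ sep).
- by move=> i k; apply: center_pair_line_polynomial.
- rewrite /h /nondegenerate !alt // !bet // !z0E.
  rewrite [\prod_i ma 0 i]big1 => [|i _]; last exact: maE.
  rewrite [\prod_i mb 0 i]big1 => [|i _]; last exact: mbE.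
  have d01 : Q' 0 1 - s * Q 0 1 - (Q' 1 1 - s * Q 1 1) != 0.
    by apply: contraNneq z01 => e; apply/eqP; rewrite -[RHS]e; ring.
  have g1 : (Q' 0 1 - s * Q 0 1) * Q 1 1 - (Q' 1 1 - s * Q 1 1) * Q 0 1 != 0.
    by apply: contraNneq gap => e; apply/eqP; rewrite -[RHS]e; ring.
  have g2 : (Q' 0 1 - s * Q 0 1) * Q' 1 1 - (Q' 1 1 - s * Q 1 1) * Q' 0 1 != 0.
    rewrite (_ : _ - _ = s * (Q 1 1 * Q' 0 1 - Q 0 1 * Q' 1 1)); last by ring.
    by rewrite mulf_neq0.
  by rewrite !mulf_neq0 ?oner_neq0 // /sg mxE addr0.
- move=> u i hu; have [_ _ _ na nb] := h_neq0 hu.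
  have nz c R : nondegenerate c R != 0 -> c != 0.
    by apply: contraNneq => ->; rewrite /nondegenerate !mxE !mul0r.
  by rewrite /center_pair; case: (i == ord0); apply: unitmx_mul_neq0 => //; apply: nz; eassumption.
- exact: zariski_closure_closed.
- by move=> u p hu up; apply: sub_zariski_closure; apply: locus up.
- move=> j; rewrite /sep; case: (j == 0); apply: regularB; apply: regularM;
    do ?[exact: regular_linear_coord | exact: regular_const].
- move=> j w c; rewrite /sep; case: (j == 0) => e; rewrite -!scalemxAr !scalecv_entry.
    by rewrite -!mulrA -mulrBr e mulr0.
  by rewrite mulrACA [X in _ - X]mulrACA -mulrBr e mulr0.
- move=> j u su; rewrite /sep /center_pair /=; case: (j =P 0) su => [->|/eqP j0] su.
    have -> : u = 0 by apply/matrixP => a b; rewrite ord1 su // mxE.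
    by rewrite mulKmx // !alt // mulrC subrr.
  have tu : t u = 0.
    by apply: su; move: j0; case: j => -[|[|//]].
  by rewrite !mulKmx // !alt // !bet // mulrC subrr.
- move=> j; rewrite /sep /center_pair /=; case: (j =P 0) => [j0|/eqP j0].
    pose u : 'rV[F]_2 := \row_i (if i == 0 then 1 else 0).
    have tu : t u = 0 by rewrite /t mxE.
    exists u; first by move=> i; rewrite j0 mxE; case: eqP => // ->.
    rewrite !mulKmx // !alt // !z0E /z /sg mxE eqxx.
    by apply: contraNneq gap => e; apply/eqP; rewrite -[RHS]e; ring.
  have lin (c : F) : 1 + c *: 'X != 0 :> {poly F}.
    by rewrite -[1]polyC1 -[c]opprK scaleNr linear_poly_neq0 // oner_neq0.
  have /poly_nonroot[c] : 'X * (1 + Q' (inord 2) 1 *: 'X) * (1 + Q' (inord 3) 1 *: 'X) *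
      (1 + (s * Q (inord 2) 1) *: 'X) * (1 + (s * Q (inord 3) 1) *: 'X) *
      (((Q' 0 1 - Q' 1 1) - s * (Q 0 1 - Q 1 1))%:P -
       (s * (Q 0 1 * Q' 1 1 - Q 1 1 * Q' 0 1)) *: 'X) != 0.
    by rewrite !mulf_neq0 ?polyX_eq0 // linear_poly_neq0 // z01.
  rewrite !hornerE => cP.
  pose u : 'rV[F]_2 := \row_i (if i == 0 then 0 else c).
  exists u.
    by move=> i ij; case: i j j0 ij => -[|[|//]] ? [[|[|//]] ?].
  rewrite !mulKmx // !alE !beE ![\prod_(_ | _) _]big_mkcond !big_ord_recl !big_ord0 /=.
  have -> : lift ord0 ord0 = 1 :> 'I_4 by apply: val_inj.
  have -> : lift ord0 (lift ord0 ord0) = inord 2 :> 'I_4.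
    by apply: val_inj; rewrite /= inordK.
  have -> : lift ord0 (lift ord0 (lift ord0 ord0)) = inord 3 :> 'I_4.
    by apply: val_inj; rewrite /= inordK.
  have tu : t u = c by rewrite /t mxE.
  have su : sg u = s by rewrite /sg mxE addr0.
  rewrite /z /ma /mb tu su.
  apply: contraNneq (mulf_neq0 (mulf_neq0 z0 z1) cP) => e.
  by apply/eqP/oppr_inj; rewrite oppr0 -[RHS]e; ring.
Qed.

End SixNormalForm.

Lemma six_points : @for_generic F 3 6 (fun x y => dim_at_least 2 (centers_variety x y)).
Proof.
have gC := generically_and (generically_and (@generically_basis F 2)
  (@generically_coord_neq0 F 2 0)) (@generically_cross_ratio F 2 0 1 isT).
apply: (for_generic_of gC) => v x y vxy [[[bx by'] c0] gap].
have [T uT xT] := exists_normal_form bx (fun i => (c0 i).1) (represents_xmat vxy).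
have [T' uT' yT] := exists_normal_form by' (fun i => (c0 i).2) (represents_ymat vxy).
set Q := \matrix_(_, _) _ in xT; set Q' := \matrix_(_, _) _ in yT.
have QE i j : Q i j = coordmx (xmat v) i j / coordmx (xmat v) i 0 by rewrite mxE.
have Q'E i j : Q' i j = coordmx (ymat v) i j / coordmx (ymat v) i 0 by rewrite mxE.
have Q1 i : Q i 0 = 1 by rewrite QE divff //; case: (c0 i).
have Q'1 i : Q' i 0 = 1 by rewrite Q'E divff //; case: (c0 i).
have gapQ : Q 1 1 * Q' 0 1 - Q 0 1 * Q' 1 1 != 0.
  have [x0 y0] := c0 0; have [x1 y1] := c0 1.
  rewrite !QE !Q'E; move: gap x0 y0 x1 y1; rewrite /cross_ratio_gap.
  move: (coordmx (xmat v)) (coordmx (ymat v)) => X Y gap x0 y0 x1 y1.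
  rewrite (_ : _ - _ = (X 0 0 * X 1 1 * Y 1 0 * Y 0 1 - X 1 0 * X 0 1 * Y 0 0 * Y 1 1) /
    (X 0 0 * X 1 0 * Y 0 0 * Y 1 0)).
    by apply: mulf_neq0; rewrite // invr_neq0 // !mulf_neq0.
  by field; rewrite x0 x1 y0 y1.
have [s [s0 z0 z1 z01]] := exists_base_slope gapQ.
exact: six_points_dim uT uT' Q1 Q'1 xT yT gapQ s s0 z0 z1 z01.
Qed.

End SixPoints.

(** * Seven points *)

Section SevenPoints.
Variable F : numClosedFieldType.

(** If G0 is invertible, a * G0 - G1 is singular for every eigenvalue a of
   G1 * G0 ^ -1. *)
Lemma singular_in_pencil n (G0 G1 : 'M[F]_n.+1) :
  exists s t, ((s != 0) || (t != 0)) /\ (\rank (s *: G0 + t *: G1)%R <= n)%N.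
Proof.
have rank_lt (G : 'M[F]_n.+1) : G \notin unitmx -> (\rank G <= n)%N.
  by rewrite -row_free_unit /row_free -ltnS ltn_neqAle rank_leq_row andbT.
have [uG0|nG0] := boolP (G0 \in unitmx); last first.
  have e : 1 *: G0 + 0 *: G1 = G0 by rewrite scale1r scale0r addr0.
  by exists 1, 0; rewrite oner_neq0 e; split=> //; apply: rank_lt.
have [a /eigenvalueP[v va v0]] := eigenvalue_closed (G1 *m invmx G0) (ltn0Sn n).
exists a, (-1); rewrite oppr_eq0 oner_neq0 orbT; split=> //.
apply: rank_lt; apply: contraNN v0 => uG; apply/eqP.
rewrite -[LHS](mulmxK uG) mulmxDr -scalemxAr scaleN1r mulmxN.
have -> : v *m G1 = a *: (v *m G0).
  by rewrite -[G1](mulmxKV uG0) mulmxA va -scalemxAl.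
by rewrite subrr mul0mx.
Qed.

Section Matching.
Implicit Types (X Y : 'M[F]_(4, 4 + 3)) (S : 'M[F]_(4 + 3)).

(** The columns of S are linear relations between the x_i, its rows are linear
   relations between the y_i: S is a sum of tensors k x l, and the diagonal
   condition says that the coordinatewise products k_i l_i add up to 0. *)
Definition bilinear_relation X Y S : Prop :=
  [/\ X *m S = 0, S *m Y^T = 0 & forall i, S i i = 0].

Lemma bilinear_relation_tr X Y S :
  bilinear_relation X Y S -> bilinear_relation Y X S^T.
Proof.
move=> [XS SY dS]; split=> [||i]; last by rewrite mxE.
  by rewrite -[Y]trmxK -trmx_mul SY trmx0.
by rewrite -trmx_mul XS trmx0.
Qed.

Lemma relation_coord X n (l : 'M[F]_(4 + 3, n)) : X *m l = 0 ->
  \det (lsubmx X) *: usubmx l = - (coordmx X *m dsubmx l).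
Proof.
move=> Xl; apply/eqP; rewrite -addr_eq0; apply/eqP.
rewrite -mul_scalar_mx -mul_adj_mx /coordmx -!mulmxA -mulmxDr.
by rewrite -mul_row_col hsubmxK vsubmxK Xl mulmx0.
Qed.

(** The matrix of the linear system met in bilinear_relation_first_row: its
   columns correspond to the entries (1, 0), (1, 2), (2, 0), (2, 1) of the lower
   right block. *)
Definition first_row_mx X Y : 'M[F]_4 :=
  \matrix_(i, k) (coordmx X i (if (k < 2)%N then 1 else inord 2) *
                  coordmx Y i (nth 0 [:: 0; inord 2; 0; 1] k)).

(** A bilinear relation whose row of index 4 vanishes has only four possibly
   nonzero entries in its lower right 3 x 3 block, which determines it; the
   first four diagonal entries give a linear system for them. *)
Lemma bilinear_relation_first_row X Y S :
  basis_condition X -> basis_condition Y -> first_row_mx X Y \in unitmx ->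
  bilinear_relation X Y S -> (forall j, S (rshift 4 0) j = 0) -> S = 0.
Proof.
move=> bX bY uD [XS SY dS] S0.
pose dX := \det (lsubmx X); pose dY := \det (lsubmx Y).
have dX0 : dX != 0 by rewrite -unitfE -unitmxE.
have dY0 : dY != 0 by rewrite -unitfE -unitmxE.
have rowS i j : dX * S (lshift 3 i) j = - \sum_a coordmx X i a * S (rshift 4 a) j.
  have /matrixP/(_ i j) := relation_coord XS.
  rewrite mxE [usubmx _ _ _]mxE [in RHS]mxE [in RHS]mxE => ->.
  by congr (- _); apply: eq_bigr => a _; rewrite [dsubmx _ _ _]mxE.
have YS : Y *m S^T = 0 by rewrite -[Y]trmxK -trmx_mul SY trmx0.
have colS i j : dY * S j (lshift 3 i) = - \sum_b coordmx Y i b * S j (rshift 4 b).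
  have /matrixP/(_ i j) := relation_coord YS.
  rewrite mxE [usubmx _ _ _]mxE [S^T _ _]mxE [in RHS]mxE [in RHS]mxE => ->.
  by congr (- _); apply: eq_bigr => a _; rewrite [dsubmx _ _ _]mxE [S^T _ _]mxE.
pose f a b := S (rshift 4 a) (rshift 4 b).
have sum3 (g : 'I_3 -> F) : \sum_a g a = g 0 + g 1 + g (inord 2).
  rewrite !big_ord_recl big_ord0 addr0 addrA; congr (_ + g _ + g _); apply: val_inj => //=.
  by rewrite inordK.
pose w : 'cV[F]_4 := \col_k nth 0 [:: f 1 0; f 1 (inord 2); f (inord 2) 0; f (inord 2) 1] k.
have w0 : w = 0.
  rewrite -[LHS](mulKmx uD) (_ : first_row_mx X Y *m w = 0) ?mulmx0 //.
  apply/matrixP => i j; rewrite ord1 mxE [RHS]mxE.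
  have := dS (lshift 3 i) => /(congr1 (fun z => dX * (dY * z))).
  rewrite mulrCA rowS !mulr0 mulrN mulr_sumr sum3 => /eqP.
  rewrite oppr_eq0 => /eqP e.
  apply: oppr_inj; rewrite oppr0 -[RHS]e !(mulrCA dY) !colS !sum3 !S0.
  rewrite !big_ord_recl big_ord0 ![first_row_mx _ _ _ _]mxE ![w _ _]mxE /= !dS /f /bump /=.
  by ring.
have wE (k : 'I_4) : nth 0 [:: f 1 0; f 1 (inord 2); f (inord 2) 0; f (inord 2) 1] k = 0.
  by have /matrixP/(_ k 0) := w0; rewrite !mxE.
have ord3 (a : 'I_3) : [\/ a = 0, a = 1 | a = inord 2].
  by case: a => -[|[|[|//]]] ha; [apply: Or31 | apply: Or32 | apply: Or33];
    apply: val_inj; rewrite //= inordK.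
have f0 a b : f a b = 0.
  have [->|->|->] := ord3 a; first exact: S0.
    have [->|->|->] := ord3 b; [exact: (wE (Ordinal (isT : 0 < 4)%N)) | exact: dS | exact: (wE (Ordinal (isT : 1 < 4)%N))].
  have [->|->|->] := ord3 b; [exact: (wE (Ordinal (isT : 2 < 4)%N)) | exact: (wE (Ordinal (isT : 3 < 4)%N)) | exact: dS].
have Sr a j : S (rshift 4 a) j = 0.
  have [i ->|b ->] := split_ordP j; last exact: f0.
  apply: (mulfI dY0); rewrite colS mulr0 big1 ?oppr0 // => b _.
  by rewrite -/(f a b) f0 mulr0.
apply/matrixP => i j; rewrite mxE.
have [k ->|a ->] := split_ordP i; last exact: Sr.
apply: (mulfI dX0); rewrite rowS mulr0 big1 ?oppr0 // => b _.
by rewrite Sr mulr0.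
Qed.

Lemma bilinear_relation_perm (s : 'S_(4 + 3)) X Y S : bilinear_relation X Y S ->
  bilinear_relation (col_perm s X) (col_perm s Y) (row_perm s (col_perm s S)).
Proof.
move=> [XS SY dS]; split=> [||i]; last by rewrite !mxE.
  apply/matrixP => i j; have /matrixP/(_ i (s j)) := XS; rewrite !mxE => e; rewrite -[RHS]e.
  by rewrite [RHS](reindex_inj (@perm_inj _ s)); apply: eq_bigr => k _; rewrite !mxE.
apply/matrixP => i j; have /matrixP/(_ (s i) j) := SY; rewrite !mxE => e; rewrite -[RHS]e.
by rewrite [RHS](reindex_inj (@perm_inj _ s)); apply: eq_bigr => k _; rewrite !mxE.
Qed.

(** Quantified over all renumberings, so that statements about particular
   indices apply to all of them. *)
Definition general_position X Y : Prop := forall s : 'S_(4 + 3),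
  [/\ basis_condition (col_perm s X), basis_condition (col_perm s Y),
      first_row_mx (col_perm s X) (col_perm s Y) \in unitmx &
      cross_ratio_gap 0 1 (col_perm s X) (col_perm s Y) != 0].

Lemma bilinear_relation_row X Y S m : general_position X Y ->
  bilinear_relation X Y S -> (forall j, S m j = 0) -> S = 0.
Proof.
move=> gXY rS Sm; pose s : 'S_(4 + 3) := tperm (rshift 4 0) m.
have [bX bY uD _] := gXY s.
have /matrixP S0 : row_perm s (col_perm s S) = 0.
  apply: bilinear_relation_first_row bX bY uD (bilinear_relation_perm s rS) _ => j.
  by rewrite !mxE tpermL Sm.
apply/matrixP => i j; have := S0 (s^-1 i)%g (s^-1 j)%g.
by rewrite !mxE !permKV.
Qed.

Lemma bilinear_relation_col X Y S m : general_position Y X ->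
  bilinear_relation X Y S -> (forall j, S j m = 0) -> S = 0.
Proof.
move=> gYX /bilinear_relation_tr rS Sm; apply: trmx_inj; rewrite trmx0.
by apply: (bilinear_relation_row gYX rS (m := m)) => j; rewrite mxE Sm.
Qed.

(** ** Existence of a bilinear relation of rank two *)

Definition relation_basis X : 'M[F]_(4 + 3, 3) :=
  col_mx (- coordmx X) (\det (lsubmx X))%:M.

Lemma mul_relation_basis X : X *m relation_basis X = 0.
Proof.
rewrite -{1}[X]hsubmxK mul_row_col mulmxN coordmxE mul_mx_scalar.
by rewrite addrC subrr.
Qed.

Lemma relation_basis_free X : basis_condition X -> row_free (relation_basis X)^T.
Proof.
move=> bX; rewrite /row_free eqn_leq rank_leq_row /=.
have dX0 : \det (lsubmx X) != 0 by rewrite -unitfE -unitmxE.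
rewrite (leq_trans _ (mxrankM_maxl _ (col_mx 0 1%:M))) // /relation_basis.
rewrite tr_col_mx mul_row_col mulmx0 add0r mulmx1 tr_scalar_mx.
by rewrite mxrank_unit // unitmxE det_scalar unitfE expf_neq0.
Qed.

(** The bilinear relations are the matrices N G N'^T, with N and N' bases of the
   relations; the seven diagonal conditions leave at least two of the nine
   dimensions of the space of matrices G. *)
Lemma two_bilinear_relations X Y : exists A : 'M[F]_(2, 3 * 3), row_free A /\
  forall w : 'rV_2, forall i,
    (relation_basis X *m vec_mx (w *m A) *m (relation_basis Y)^T) i i = 0.
Proof.
pose L : 'M[F]_(3 * 3, 4 + 3) := colsub (fun i => mxvec_index i i)
  (lin_mulmx (relation_basis X) *m lin_mulmxr (relation_basis Y)^T).
have [|A rA AL] := @rank_submx_exists F _ _ 2 (kermx L).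
  by rewrite mxrank_ker (leq_trans _ (leq_sub2l 9 (rank_leq_col L))).
exists A; split; first by rewrite /row_free rA.
move=> w i; set G := vec_mx _.
have e : mxvec G *m (lin_mulmx (relation_basis X) *m lin_mulmxr (relation_basis Y)^T) =
    mxvec (relation_basis X *m G *m (relation_basis Y)^T).
  by rewrite mulmxA !mul_vec_lin.
have /matrixP/(_ 0 i) : mxvec G *m L = 0.
  by rewrite vec_mxK -mulmxA (sub_kermxP AL) mulmx0.
by rewrite mulmx_colsub e mxE mxvecE => ->; rewrite mxE.
Qed.

Lemma exists_singular_relation X Y : basis_condition X -> basis_condition Y ->
  exists G : 'M[F]_3, [/\ G != 0, (\rank G <= 2)%N &
    bilinear_relation X Y (relation_basis X *m G *m (relation_basis Y)^T)].
Proof.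
move=> bX bY; have [A [fA AS]] := two_bilinear_relations X Y.
have [a [b [ab rG]]] := singular_in_pencil (vec_mx (row 0 A)) (vec_mx (row 1 A)).
pose w : 'rV[F]_2 := \row_j (if j == 0 then a else b).
exists (vec_mx (w *m A)); split.
- rewrite vec_mx_eq0 mulmx_free_eq0 //; apply: contraL ab => /eqP w0.
  have /matrixP/(_ 0 0) := w0; have /matrixP/(_ 0 1) := w0; rewrite !mxE /= => -> ->.
  by rewrite eqxx.
- suff -> : vec_mx (w *m A) = (a *: vec_mx (row 0 A) + b *: vec_mx (row 1 A))%R by [].
  apply/matrixP => i j; rewrite !mxE sum_ord2 !mxE /=; congr (_ + _).
- split; first by rewrite !mulmxA mul_relation_basis !mul0mx.
    by rewrite -!mulmxA -trmx_mul mul_relation_basis trmx0 !mulmx0.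
  exact: AS.
Qed.

(** The two relations span a pencil with a singular member, of rank at most two.
   A relation of rank one would be a single tensor k x l with k_i l_i = 0 for
   all i; one of its rows vanishes, or else l does. *)
Lemma exists_rank_two_relation X Y : general_position X Y -> general_position Y X ->
  exists (c : 'M[F]_(4 + 3, 2)) (d : 'M[F]_(2, 4 + 3)),
  [/\ X *m c = 0, d *m Y^T = 0, row_free d, forall i, (c *m d) i i = 0 &
      forall i, (exists j, c i j != 0) /\ (exists j, d j i != 0)].
Proof.
move=> gXY gYX; have [bX bY _ _] := gXY 1%g; rewrite !col_perm1 in bX bY.
have [G [G0 rG rS]] := exists_singular_relation bX bY.
set S := _ *m _ in rS.
have fX := relation_basis_free bX; have fY := relation_basis_free bY.
have S0 : S != 0.
  rewrite /S mulmx_free_eq0 // -trmx_eq0 trmx_mul mulmx_free_eq0 // trmx_eq0 //.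
have [r [g1 [g2 [rr Ge fg2]]]] : exists r (g1 : 'M[F]_(3, r)) (g2 : 'M[F]_(r, 3)),
    [/\ (r <= 2)%N, G = g1 *m g2 & row_free g2].
  by exists (\rank G), (col_base G), (row_base G); rewrite mulmx_base row_base_free.
pose c := relation_basis X *m g1; pose d := g2 *m (relation_basis Y)^T.
have Scd : S = c *m d by rewrite /S Ge /c /d !mulmxA.
have Xc : X *m c = 0 by rewrite mulmxA mul_relation_basis mul0mx.
have dY : d *m Y^T = 0 by rewrite -mulmxA -trmx_mul mul_relation_basis trmx0 mulmx0.
have fd : row_free d by rewrite /row_free mxrankMfree.
have [_ _ dS] := rS.
have rowS i : exists j, S i j != 0.
  apply: contrapT => /forallNP Si; case/eqP: S0.
  by apply: (bilinear_relation_row gXY rS (m := i)) => j; apply/eqP/negPn/negP/Si.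
have colS i : exists j, S j i != 0.
  apply: contrapT => /forallNP Si; case/eqP: S0.
  by apply: (bilinear_relation_col gYX rS (m := i)) => j; apply/eqP/negPn/negP/Si.
clearbody c d; case: r rr g1 g2 c d {Ge fg2} Scd Xc dY fd => [|[|[|//]]] _ g1 g2 c d Scd Xc dY fd.
- by case/eqP: S0; rewrite Scd; apply/matrixP => i j; rewrite !mxE big_ord0.
- have [j] := rowS 0; have [k] := colS 0.
  move: (dS 0); rewrite Scd !mxE !big_ord1 => /eqP.
  by rewrite mulf_eq0 => /orP[] /eqP ->; rewrite ?mul0r ?mulr0 eqxx.
- exists c, d; split=> // i; first by rewrite -Scd.
  have nz2 (p q : 'I_2 -> F) : \sum_j p j * q j != 0 -> (exists j, p j != 0) /\ (exists j, q j != 0).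
    rewrite sum_ord2 => pq; split; apply: contrapT => /forallNP h; case/eqP: pq.
      have [p0 p1] : p 0 = 0 /\ p 1 = 0 by split; apply/eqP/negPn/negP/h.
      by rewrite p0 p1 !mul0r addr0.
    have [q0 q1] : q 0 = 0 /\ q 1 = 0 by split; apply/eqP/negPn/negP/h.
    by rewrite q0 q1 !mulr0 addr0.
  split.
    by have [j] := rowS i; rewrite Scd mxE => /nz2[].
  by have [j] := colS i; rewrite Scd mxE => /nz2[].
Qed.

Lemma rank_basis_condition X : basis_condition X -> \rank X = 4%N.
Proof.
move=> bX; apply/eqP; rewrite eqn_leq rank_leq_row /= -[X in (X <= _)%N](mxrank_unit bX).
have -> : lsubmx X = X *m col_mx 1%:M 0.
  by rewrite -{2}[X]hsubmxK mul_row_col mulmx1 mulmx0 addr0.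
exact: mxrankM_maxl.
Qed.

(** Writing a relation of rank two as c d, the rows c_i and the columns d_i are
   orthogonal in the plane, so d_i is proportional to c_i turned by a right
   angle; the ratios rescale the relations in d between the y_i into relations
   between the x_i. *)
Lemma exists_matching_cameras X Y : general_position X Y -> general_position Y X ->
  exists (A B : 'M[F]_(3, 4)) (lam : 'rV[F]_(4 + 3)), [/\ \rank A = 3%N, \rank B = 3%N, forall i, lam 0 i != 0 &
    A *m X = B *m Y *m diag_mx lam].
Proof.
move=> gXY gYX; have [bX bY _ _] := gXY 1%g; rewrite !col_perm1 in bX bY.
have [c [d [Xc dY fd cd cd0]]] := exists_rank_two_relation gXY gYX.
have /choice[f fP] : forall i, exists e, [/\ e != 0, d 0 i = - (e * c i 1) & d 1 i = e * c i 0].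
  move=> i; have [[j cj] [k dk]] := cd0 i.
  have := cd i; rewrite mxE sum_ord2 => o.
  have or2 (q : 'I_2) : q = 0 \/ q = 1.
    by case: q => -[|[|//]] hq; [left | right]; apply: val_inj.
  have dnz : d 0 i != 0 \/ d 1 i != 0 by case: (or2 k) dk => ->; [left | right].
  have [c0|c0] := eqVneq (c i 0) 0.
    have c1 : c i 1 != 0 by case: (or2 j) cj => -> //; rewrite c0 eqxx.
    have d1 : d 1 i = 0.
      by move: o; rewrite c0 mul0r add0r => /eqP; rewrite mulf_eq0 (negPf c1) => /eqP.
    exists (- (d 0 i / c i 1)); rewrite c0 d1 mulr0; split=> //.
      by case: dnz => [d0|]; [rewrite oppr_eq0 mulf_neq0 ?invr_neq0 | rewrite d1 eqxx].
    by rewrite mulNr opprK divfK.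
  exists (d 1 i / c i 0); rewrite divfK //.
  have d0 : d 0 i = - (d 1 i / c i 0 * c i 1).
    apply: (mulfI c0); apply/eqP; rewrite -subr_eq0 -[X in _ == X]o; apply/eqP.
    by field.
  split=> //; rewrite mulf_neq0 ?invr_neq0 //.
  by case: dnz => // ; rewrite d0; apply: contraNneq => ->; rewrite !mul0r oppr0.
pose lam : 'rV[F]_(4 + 3) := \row_i f i.
have lam0 i : lam 0 i != 0 by rewrite mxE; case: (fP i).
pose M := diag_mx (map_mx GRing.inv lam) *m X^T.
have dM : d *m M = 0.
  have -> : d *m M = (\matrix_(a, i) (if a == 0 then - c i 1 else c i 0)) *m X^T.
    rewrite mulmxA; congr (_ *m _); apply/matrixP => a i.
    have [f0 e0 e1] := fP i.
    rewrite mul_mx_diag !mxE; case: eqP => [->|/eqP a0].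
      by rewrite e0 mulNr mulrAC divff // mul1r.
    have -> : a = 1 by case: a a0 => -[|[|//]] ha // _; apply: val_inj.
    by rewrite e1 mulrAC divff // mul1r.
  apply/matrixP => a k; have /matrixP Xc0 := Xc.
  have {}Xc0 j : \sum_i c i j * X k i = 0.
    by have := Xc0 k j; rewrite !mxE => e; rewrite -[RHS]e; apply: eq_bigr => i _; rewrite mulrC.
  rewrite !mxE; have [->|a0] := eqVneq a 0.
    rewrite -[RHS]oppr0 -[in RHS](Xc0 1) -sumrN.
    by apply: eq_bigr => i _; rewrite !mxE eqxx mulNr.
  rewrite -[RHS](Xc0 0).
  by apply: eq_bigr => i _; rewrite !mxE (negPf a0).
pose W := kermx Y^T *m M.
have rW : (\rank W <= 1)%N.
  have := mxrank_mul_ker (kermx Y^T) M; rewrite -/W mxrank_ker mxrank_tr.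
  rewrite (rank_basis_condition bY) => e.
  have : (2 <= \rank (kermx Y^T :&: kermx M)%MS)%N.
    move: fd; rewrite /row_free => /eqP rd; rewrite -[X in (X <= _)%N]rd.
    apply: mxrankS; rewrite sub_capmx.
    by apply/andP; split; apply/sub_kermxP.
  by move: e; case: (\rank W) => [|[|w]] //; case: (\rank _) => [|[|q]] // /eqP;
    rewrite !addSn !addnS !eqSS.
have [|A rA AW] := @rank_submx_exists F _ _ 3 (kermx W^T).
  by rewrite mxrank_ker mxrank_tr; case: (\rank W) rW => [|[]].
have [|B rB e] := matching_camera (Y := Y) (rank_basis_condition bX) rA lam0.
  move=> l Yl; apply: trmx_inj; rewrite trmx0 -!mulmxA !trmx_mul tr_diag_mx.
  have /submxP[u ->] : (l^T <= kermx Y^T)%MS.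
    by apply/sub_kermxP; rewrite -trmx_mul Yl trmx0.
  rewrite (_ : _ *m _ = u *m (W *m A^T)); last by rewrite /W /M !mulmxA.
  have -> : W *m A^T = 0 by apply: trmx_inj; rewrite trmx_mul trmxK (sub_kermxP AW) trmx0.
  by rewrite mulmx0.
by exists A, B, lam.
Qed.

(** ** Centres off the secant lines *)

Lemma camera_kernel (A : 'M[F]_(3, 4)) (u v : 'cV[F]_4) :
  \rank A = 3%N -> A *m u = 0 -> A *m v = 0 -> u != 0 -> exists e, v = e *: u.
Proof.
move=> rA Au Av u0.
have ker (z : 'cV[F]_4) : A *m z = 0 -> (z^T <= kermx A^T)%MS.
  by move=> Az; apply/sub_kermxP; rewrite -trmx_mul Az trmx0.
have := mxrank_leqif_sup (ker u Au).
rewrite mxrank_ker [\rank A^T]mxrank_tr rA rank_rV trmx_eq0 u0 /= => -[_] /esym uK.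
have /sub_rVP[e eE] := submx_trans (ker v Av) uK.
by exists e; apply: trmx_inj; rewrite eE linearZ.
Qed.

Lemma exists_camera_center (A : 'M[F]_(3, 4)) :
  \rank A = 3%N -> exists a : proj F 3, camera_with_center A a.
Proof.
move=> rA; have : kermx A^T != 0.
  by rewrite -mxrank_eq0 mxrank_ker mxrank_tr rA.
move=> /rowV0Pn[u /sub_kermxP uA u0].
have [|a aE] := @exists_point F 3 u^T; first by rewrite trmx_eq0.
exists a; apply: camera_with_centerP aE rA _.
by apply: trmx_inj; rewrite trmx_mul trmxK uA trmx0.
Qed.

(** If the centre of A were on the line x_3 x_4, then the images of x_3 and x_4,
   and hence those of y_3 and y_4, would coincide; projecting once more from
   this image point identifies the cross-ratios of the points 1, 2, 5, 6 seen
   from the lines x_3 x_4 and y_3 y_4. Here w holds the coordinates of the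
   centre. *)
Lemma center_off_first_secant X Y (A B : 'M[F]_(3, 4)) (lam : 'rV[F]_(4 + 3))
    (w : 'cV[F]_4) :
  basis_condition X -> basis_condition Y -> cross_ratio_gap 0 1 X Y != 0 ->
  \rank A = 3%N -> (forall i, lam 0 i != 0) -> A *m X = B *m Y *m diag_mx lam ->
  w 0 0 = 0 -> w 1 0 = 0 -> A *m (lsubmx X *m w) = 0 -> w = 0.
Proof.
move=> bX bY gap rA lam0 e w00 w10 Aw; apply: contrapT => /eqP w0.
pose l1 := lsubmx lam; pose l2 := rsubmx lam.
have l10 i : l1 0 i != 0 by rewrite mxE.
have l20 i : l2 0 i != 0 by rewrite mxE.
have diagK n (l : 'rV[F]_n) : (forall i, l 0 i != 0) ->
    diag_mx l *m diag_mx (map_mx GRing.inv l) = 1%:M.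
  move=> l0; apply/matrixP => i j; rewrite mul_diag_mx !mxE.
  by have [->|] := eqVneq i j; rewrite ?divff // !mulr0n mulr0.
have [e1 e2] : A *m lsubmx X = B *m lsubmx Y *m diag_mx l1 /\
    A *m rsubmx X = B *m rsubmx Y *m diag_mx l2.
  move: e; rewrite -{1}[X]hsubmxK -{1}[Y]hsubmxK -[lam]hsubmxK diag_mx_row.
  by rewrite !mul_mx_row mul_row_block !mulmx0 addr0 add0r => /eq_row_mx.
clearbody l1 l2.
pose dX := \det (lsubmx X); pose dY := \det (lsubmx Y).
have dX0 : dX != 0 by rewrite -unitfE -unitmxE.
have dY0 : dY != 0 by rewrite -unitfE -unitmxE.
pose R := dY *: (coordmx X *m diag_mx (map_mx GRing.inv l2)) -
          dX *: (diag_mx (map_mx GRing.inv l1) *m coordmx Y).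
have AR : A *m (lsubmx X *m R) = 0.
  rewrite /R; move: (coordmx X) (coordmx Y) (coordmxE X) (coordmxE Y) => CX CY eX eY.
  rewrite mulmxBr mulmxBr -!scalemxAr !mulmxA -(mulmxA A _ CX) eX -scalemxAr e2.
  rewrite e1 -(mulmxA _ (diag_mx l1)) diagK // mulmx1 -(mulmxA B _ CY) eY.
  rewrite -scalemxAr -scalemxAl -(mulmxA _ (diag_mx l2)) diagK //.
  by rewrite mulmx1 !scalerA mulrC subrr.
have R0 i j : w i 0 = 0 -> R i j = 0.
  move=> wi; have ARj : A *m (lsubmx X *m col j R) = 0.
    by rewrite colE !mulmxA -(mulmxA A) AR mul0mx.
  have [c cE] := camera_kernel rA Aw ARj (unitmx_mul_neq0 bX w0).
  have : col j R = c *: w by rewrite -[LHS](mulKmx bX) cE -scalemxAr mulKmx.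
  by move=> /matrixP/(_ i 0); rewrite mxE [in RHS]mxE wi mulr0.
have cE i j : w i 0 = 0 -> coordmx X i j = dX / dY / l1 0 i * l2 0 j * coordmx Y i j.
  move=> /(R0 i j); rewrite /R mul_diag_mx mul_mx_diag.
  move: (coordmx X) (coordmx Y) (l10 i) (l20 j) => CX CY a0 b0.
  rewrite !mxE => /eqP; rewrite subr_eq0 => /eqP h.
  have -> : CX i j = dY * (CX i j / l2 0 j) * (l2 0 j / dY) by field; rewrite b0 dY0.
  by rewrite h; field; rewrite a0 dY0.
case/eqP: gap; rewrite /cross_ratio_gap !cE //.
by ring.
Qed.

Lemma center_off_secants X Y (A B : 'M[F]_(3, 4)) (lam : 'rV[F]_(4 + 3)) x a :
  general_position X Y -> \rank A = 3%N -> (forall i, lam 0 i != 0) ->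
  A *m X = B *m Y *m diag_mx lam -> represents (fun i => col i X) x ->
  camera_with_center A a ->
  forall i j : 'I_(4 + 3), i != j -> ~ (val a <= val (x i) + val (x j))%VS.
Proof.
move=> gXY rA lam0 e xX [_ Aa] i j ij; have [z z0 az] := proj_repr a.
rewrite az (xX i) (xX j) -memvE.
move=> /memv_addP[_ /vlineP[c ->]] [_ /vlineP[c' ->]] zE.
have Az : A *m z = 0.
  apply/eqP; rewrite -memv0 -[0%VS]Aa (image_pointE A az); exact: memv_line.
pose p : 'I_(4 + 3) := lshift 3 (inord 2); pose q : 'I_(4 + 3) := lshift 3 (inord 3).
have pq : p != q by rewrite -val_eqE /= !inordK.
pose s : 'S_(4 + 3) := (tperm p i * tperm (tperm p i q) j)%g.
have qi : tperm p i q != i.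
  by apply: contraNneq pq => h; apply/eqP/(@perm_inj _ (tperm p i)); rewrite h tpermL.
have sp : s p = i by rewrite permM tpermL (tpermD qi) // eq_sym.
have sq : s q = j by rewrite permM tpermL.
have [bX bY _ gap] := gXY s.
pose w : 'cV[F]_4 := c *: delta_mx (inord 2) 0 + c' *: delta_mx (inord 3) 0.
have zw : z = lsubmx (col_perm s X) *m w.
  rewrite zE mulmxDr -!scalemxAr -!colE; congr (_ *: _ + _ *: _).
    by apply/matrixP => k l; rewrite !mxE sp.
  by apply/matrixP => k l; rewrite !mxE sq.
have es : A *m col_perm s X = B *m col_perm s Y *m diag_mx (col_perm s lam).
  have /matrixP eM := e; apply/matrixP => k l.
  have := eM k (s l); rewrite !mul_mx_diag !mxE => h.
  rewrite [LHS](eq_bigr (fun j => A k j * X j (s l))) => [|m _]; last by rewrite mxE.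
  by rewrite h; congr (_ * _); apply: eq_bigr => m _; rewrite mxE.
case/eqP: z0; rewrite zw (_ : w = 0) ?mulmx0 //.
apply: center_off_first_secant bX bY gap rA _ es _ _ _ => //.
- by move=> k; rewrite mxE.
- by rewrite !mxE -!val_eqE /= !inordK //= !mulr0 addr0.
- by rewrite !mxE -!val_eqE /= !inordK //= !mulr0 addr0.
- by rewrite -zw.
Qed.

(** The witness turns the matrix of the linear system into the identity. *)
Lemma generically_first_row :
  generically (fun v : 'I_(4 + 3) + 'I_(4 + 3) -> 'cV[F]_4 =>
    \det (first_row_mx (xmat v) (ymat v)) != 0).
Proof.
pose QX : 'M[F]_(4, 3) := \matrix_(i, a) (((a == 1 :> nat) && (i < 2)%N) ||
  ((a == 2 :> nat) && (2 <= i)%N))%:R.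
pose QY : 'M[F]_(4, 3) := \matrix_(i, a) (((a == 0 :> nat) && ~~ odd i) ||
  ((a == 1 :> nat) && (i == 3 :> nat)) || ((a == 2 :> nat) && (i == 1 :> nat)))%:R.
apply: (@generically_mx _ _ (fun X Y => \det (first_row_mx X Y))
  (row_mx 1%:M QX) (row_mx 1%:M QY)).
  apply: regular_det => i k; under eq_fun do rewrite mxE.
  by apply: regularM; apply: regular_coordmx; [exact: regular_xmat | exact: regular_ymat].
rewrite (_ : first_row_mx _ _ = 1%:M) ?det1 ?oner_neq0 //.
apply/matrixP => i k; rewrite mxE !coordmx_row !mxE -val_eqE.
by case: i => -[|[|[|[|//]]]] ?; case: k => -[|[|[|[|//]]]] ?;
  rewrite /= ?inordK //= ?mulr1 ?mulr0 ?mul0r.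
Qed.

Lemma generically_general_position :
  generically (fun v : 'I_(4 + 3) + 'I_(4 + 3) -> 'cV[F]_4 =>
    general_position (xmat v) (ymat v) /\ general_position (ymat v) (xmat v)).
Proof.
have g0 := generically_and (generically_and (@generically_basis F 3) generically_first_row)
  (@generically_cross_ratio F 3 0 1 isT).
pose ren (s : 'S_(4 + 3)) (q : 'I_(4 + 3) + 'I_(4 + 3)) :=
  match q with inl i => inl (s i) | inr i => inr (s i) end.
have renK s : cancel (ren s^-1%g) (ren s) by move=> [] i /=; rewrite permKV.
have renK' s : cancel (ren s) (ren s^-1%g) by move=> [] i /=; rewrite permK.
have g1 := generically_forall (fun s => generically_reindex (renK s) (renK' s) g0).
pose sw (q : 'I_(4 + 3) + 'I_(4 + 3)) := match q with inl i => inr i | inr i => inl i end.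
have swK : cancel sw sw by move=> [].
have := generically_and g1 (generically_reindex swK swK g1).
have xren (v : 'I_(4 + 3) + 'I_(4 + 3) -> 'cV[F]_4) s :
    xmat (v \o ren s) = col_perm s (xmat v) by apply/matrixP => i j; rewrite !mxE.
have yren (v : 'I_(4 + 3) + 'I_(4 + 3) -> 'cV[F]_4) s :
    ymat (v \o ren s) = col_perm s (ymat v) by apply/matrixP => i j; rewrite !mxE.
have xsw (v : 'I_(4 + 3) + 'I_(4 + 3) -> 'cV[F]_4) : xmat (v \o sw) = ymat v.
  by apply/matrixP => i j; rewrite !mxE.
have ysw (v : 'I_(4 + 3) + 'I_(4 + 3) -> 'cV[F]_4) : ymat (v \o sw) = xmat v.
  by apply/matrixP => i j; rewrite !mxE.
apply: genericallyS => v [h1 h2]; split=> s.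
  by have := h1 s; rewrite xren yren unitmxE unitfE => -[[[? ?] ?] ?].
by have := h2 s; rewrite xren yren xsw ysw unitmxE unitfE => -[[[? ?] ?] ?].
Qed.

Lemma dim_at_least0 (V : set ('I_2 -> proj F 3)) p :
  zariski_closed V -> V p -> dim_at_least 0 V.
Proof.
move=> cV Vp; have [v vp] := represents_exists p.
apply: (@dim_at_least_param F 3 _ 0 (fun=> v) (fun=> 1) _ _ _ _ V (fun _ _ => 0)) => //.
- by move=> i k; apply: line_polynomial_const.
- exact: line_polynomial_const.
- exact: oner_neq0.
- by move=> _ i _; apply: represents_neq0 vp.
- move=> _ q _ vq; suff -> : q = p by [].
  by apply/funext => i; apply: val_inj; rewrite vq vp.
- by case.
- by case.
Qed.

Lemma centers_locus_neq0 X Y (x y : 'I_7 -> proj F 3) :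
  general_position X Y -> general_position Y X ->
  represents (fun i : 'I_(4 + 3) => col i X) x ->
  represents (fun i : 'I_(4 + 3) => col i Y) y ->
  exists p, centers_locus x y p.
Proof.
move=> gXY gYX xX yY.
have [A [B [lam [rA rB lam0 e]]]] := exists_matching_cameras gXY gYX.
have [a Aa] := exists_camera_center rA; have [b Bb] := exists_camera_center rB.
pose mu := map_mx GRing.inv lam.
have mu0 i : mu 0 i != 0 by rewrite mxE invr_neq0.
have e' : B *m Y = A *m X *m diag_mx mu.
  rewrite e -mulmxA (_ : diag_mx lam *m _ = 1%:M) ?mulmx1 //.
  apply/matrixP => i j; rewrite mul_diag_mx !mxE.
  by have [->|] := eqVneq i j; rewrite ?divff // !mulr0n mulr0.
have offx := center_off_secants gXY rA lam0 e xX Aa.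
have offy := center_off_secants gYX rB mu0 e' yY Bb.
have other (i : 'I_7) : exists j : 'I_7, i != j.
  by exists (i + 1); rewrite eq_sym -subr_eq0 addrAC subrr add0r.
exists (fun s : 'I_2 => if s == ord0 then a else b); split=> /=.
- move=> i ai; have [j ij] := other i; apply: (offx i j ij).
  by rewrite ai addvSl.
- move=> i bi; have [j ij] := other i; apply: (offy i j ij).
  by rewrite bi addvSl.
- by exists A, B; split=> //; apply: images_equivP lam0 e xX yY.
- move=> _; split=> -[i [j [xij]]]; [apply: offx | apply: offy];
    by apply/eqP => ij; apply: xij; rewrite ij.
Qed.

End Matching.

Lemma seven_points : @for_generic F 3 7 (fun x y => dim_at_least 0 (centers_variety x y)).
Proof.
apply: (for_generic_of generically_general_position) => v x y vxy [gXY gYX].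
have [p pl] := centers_locus_neq0 gXY gYX (represents_xmat vxy) (represents_ymat vxy).
apply: (dim_at_least0 (p := p)); first exact: zariski_closure_closed.
exact: sub_zariski_closure.
Qed.

End SevenPoints.

Theorem theorem10 (R : realType) (n : nat) :
  ((n <= 4)%N ->
     @for_generic R[i] 3 n (fun x y => centers_variety x y = setT)) /\
  ((5 <= n <= 7)%N ->
     @for_generic R[i] 3 n (fun x y =>
       dim_at_least (14 - 2 * n)%N (centers_variety x y))).
Proof.
split; first exact: at_most_four_points.
case: n => [|[|[|[|[|[|[|[|n]]]]]]]] // _.
- exact: five_points.
- exact: six_points.
- exact: seven_points.
Qed.
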